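(* Let $n \geq 2$ and $\epsilon > 0$. In the space of finitely presentable $n$-parameter persistence modules equipped with the interleaving distance, the $\epsilon$-indecomposable modules form a dense and open set.
   Context: Fix a field $\mathbb{k}$ and let $\mathbf{vec}$ be the category of finite dimensional $\mathbb{k}$-vector spaces. $\mathbf{R}^n$ is the poset $\mathbb{R}^n$ with the product (componentwise) order, viewed as a category. An $n$-parameter persistence module is a functor $M : \mathbf{R}^n \to \mathbf{vec}$; morphisms are natural transformations. For $i \in \mathbf{R}^n$, let $\mathsf{P}_i : \mathbf{R}^n \to \mathbf{vec}$ be the functor with $\mathsf{P}_i(j) = \mathbb{k}$ if $i \leq j$ and $0$ otherwise, all structure morphisms not forced to be zero being the identity. A module is finitely presentable if it is isomorphic to the cokernel of a morphism $\bigoplus_{j \in J} \mathsf{P}_j \to \bigoplus_{i \in I} \mathsf{P}_i$ with $I, J$ finite multisets of elements of $\mathbf{R}^n$. A module is decomposable if it is isomorphic to $A \oplus B$ with $A, B$ both non-zero; it is indecomposable if it is non-zero and not decomposable. For $r \in \mathbb{R}$ and $s \in \mathbf{R}^n$, $s + r$ denotes $(s_1+r,\dots,s_n+r)$. A module $M$ is strictly $\epsilon$-trivial if there exists $\epsilon' < \epsilon$ (with $\epsilon' \geq 0$) such that the structure morphism $M(r) \to M(r+\epsilon')$ is zero for every $r \in \mathbf{R}^n$. A module is $\epsilon$-indecomposable if it is isomorphic to a direct sum of an indecomposable module and a strictly $\epsilon$-trivial module. Interleavings: the shift $M[r]$ is defined by $M[r](s) = M(s+r)$, with the corresponding structure morphisms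 (and similarly $f[r]$ for morphisms $f$). For $r \geq 0$, $\eta^M_r : M \to M[r]$ is the natural transformation given by the structure morphisms $M(a) \to M(a+r)$. For $\epsilon \geq 0$, an $\epsilon$-interleaving between $M$ and $N$ is a pair of morphisms $f : M \to N[\epsilon]$, $g : N \to M[\epsilon]$ with $g[\epsilon]\circ f = \eta^M_{2\epsilon}$ and $f[\epsilon] \circ g = \eta^N_{2\epsilon}$. The interleaving distance is $d_I(M,N) = \inf\{\epsilon \geq 0 : M \text{ and } N \text{ are } \epsilon\text{-interleaved}\} \in [0,\infty]$. The space of finitely presentable $n$-parameter persistence modules is the set of isomorphism classes of finitely presentable modules $\mathbf{R}^n \to \mathbf{vec}$, with the topology generated by the open balls of $d_I$ (which is an extended metric on this set). *)

(* Defs.v *)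
From HB Require Import structures.
From mathcomp Require Import all_boot all_order all_algebra.
From mathcomp Require Import all_classical all_reals all_analysis.

Set Implicit Arguments.
Unset Strict Implicit.
Unset Printing Implicit Defensive.

Import Order.TTheory GRing.Theory Num.Theory.
Import VectorInternalTheory.
Local Open Scope classical_set_scope.
Local Open Scope ring_scope.
Local Open Scope quotient_scope.

Section LinearPair.
Variables (k : fieldType) (U V U' V' : vectType k).
Variables (f : 'Hom(U, U')) (g : 'Hom(V, V')).

Definition pair_fun (x : U * V) : U' * V' := (f x.1, g x.2).

Lemma pair_fun_linear : linear pair_fun.
Proof. by move=> a x y; rewrite /pair_fun /= !linearP. Qed.

HB.instance Definition _ :=
  GRing.isLinear.Build k (U * V)%type (U' * V')%type _ pair_fun pair_fun_linear.

Definition pair_lfun : 'Hom((U * V)%type, (U' * V')%type) := linfun pair_fun.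

Lemma pair_lfunE x : pair_lfun x = (f x.1, g x.2).
Proof. by rewrite lfunE. Qed.

End LinearPair.

Section RowMap.
Variables (k : fieldType) (m p : nat) (A : 'M[k]_(m, p)).

Definition row_lfun : 'Hom('rV[k]_m, 'rV[k]_p) := linfun (mulmxr A).

Lemma row_lfunE v : row_lfun v = v *m A.
Proof. by rewrite lfunE. Qed.

End RowMap.

Section Modules.
Variables (R : realType) (k : fieldType) (n : nat).

(* The order on ['I_n -> R] is the pointwise order of [boolp.FunOrder]. *)
Local Notation Rn := ('I_n -> R).

Record pmod := PMod {
  pobj :> Rn -> vectType k;
  pmap : forall s t : Rn, (s <= t)%O -> 'Hom(pobj s, pobj t);
  pmap_id : forall (s : Rn) (ss : (s <= s)%O), pmap ss = \1%VF;
  pmap_comp : forall (s t u : Rn) (st : (s <= t)%O) (tu : (t <= u)%O)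
    (su : (s <= u)%O), pmap su = (pmap tu \o pmap st)%VF
}.

Record pmor (M N : pmod) := PMor {
  pmor_fun :> forall s : Rn, 'Hom(M s, N s);
  pmor_nat : forall (s t : Rn) (st : (s <= t)%O),
    (pmor_fun t \o pmap M st)%VF = (pmap N st \o pmor_fun s)%VF
}.

Definition pmor_id_fun (M : pmod) (s : Rn) : 'Hom(M s, M s) := \1%VF.

Lemma pmor_id_nat (M : pmod) (s t : Rn) (st : (s <= t)%O) :
  (pmor_id_fun M t \o pmap M st)%VF = (pmap M st \o pmor_id_fun M s)%VF.
Proof. by rewrite comp_lfun1l comp_lfun1r. Qed.

Definition pmor_id (M : pmod) : pmor M M := PMor (@pmor_id_nat M).

Section Comp.
Variables (M N P : pmod) (g : pmor N P) (f : pmor M N).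

Lemma pmor_comp_nat (s t : Rn) (st : (s <= t)%O) :
  ((g t \o f t) \o pmap M st)%VF = (pmap P st \o (g s \o f s))%VF.
Proof. by rewrite -comp_lfunA pmor_nat !comp_lfunA pmor_nat. Qed.

Definition pmor_comp : pmor M P := PMor pmor_comp_nat.

End Comp.

Definition pisomorphic (M N : pmod) : Prop :=
  exists (f : pmor M N) (g : pmor N M), forall s : Rn,
    (g s \o f s)%VF = \1%VF /\ (f s \o g s)%VF = \1%VF.

Lemma pisomorphic_refl M : pisomorphic M M.
Proof. by exists (pmor_id M), (pmor_id M) => s; rewrite comp_lfun1l. Qed.

Lemma pisomorphic_sym M N : pisomorphic M N -> pisomorphic N M.
Proof. by move=> [f [g fg]]; exists g, f => s; have [] := fg s. Qed.

Lemma pisomorphic_trans N M P :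
  pisomorphic M N -> pisomorphic N P -> pisomorphic M P.
Proof.
move=> [f [g fg]] [f' [g' fg']].
exists (pmor_comp f' f), (pmor_comp g g') => s /=.
have [gf1 fg1] := fg s; have [gf2 fg2] := fg' s; split.
  by rewrite -comp_lfunA [X in (_ \o X)%VF]comp_lfunA gf2 comp_lfun1l.
by rewrite -comp_lfunA [X in (_ \o X)%VF]comp_lfunA fg1 comp_lfun1l.
Qed.

Definition pnonzero (M : pmod) : Prop := exists (s : Rn) (x : M s), x != 0.

Section Zero.
Let zobj (s : Rn) : vectType k := 'rV[k]_0.
Let zmap (s t : Rn) (st : (s <= t)%O) : 'Hom(zobj s, zobj t) := 0.
Let zmap_id (s : Rn) (ss : (s <= s)%O) : zmap ss = \1%VF.
Proof. by apply/lfunP => v; rewrite [LHS]thinmx0 [RHS]thinmx0. Qed.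
Let zmap_comp (s t u : Rn) (st : (s <= t)%O) (tu : (t <= u)%O)
  (su : (s <= u)%O) : zmap su = (zmap tu \o zmap st)%VF.
Proof. by rewrite comp_lfun0l. Qed.

Definition pzero : pmod := PMod zmap_id zmap_comp.
End Zero.

Section Sum.
Variables A B : pmod.
Let dobj (s : Rn) : vectType k := (A s * B s)%type.
Let dmap (s t : Rn) (st : (s <= t)%O) : 'Hom(dobj s, dobj t) :=
  pair_lfun (pmap A st) (pmap B st).
Let dmap_id (s : Rn) (ss : (s <= s)%O) : dmap ss = \1%VF.
Proof. by apply/lfunP => -[x y]; rewrite pair_lfunE !pmap_id !id_lfunE. Qed.
Let dmap_comp (s t u : Rn) (st : (s <= t)%O) (tu : (t <= u)%O)
  (su : (s <= u)%O) : dmap su = (dmap tu \o dmap st)%VF.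
Proof.
apply/lfunP => x; rewrite comp_lfunE !pair_lfunE /=.
by rewrite (pmap_comp A st tu su) (pmap_comp B st tu su) !comp_lfunE.
Qed.

Definition psum : pmod := PMod dmap_id dmap_comp.
End Sum.

Definition pdecomposable (M : pmod) : Prop :=
  exists A B : pmod, [/\ pnonzero A, pnonzero B & pisomorphic M (psum A B)].

Definition pindecomposable (M : pmod) : Prop :=
  pnonzero M /\ ~ pdecomposable M.

(* [P_i] takes the value ['rV_1], that is [k], at [j] if [i <= j], and ['rV_0]
   otherwise; the 1 x 1 matrix [const_mx 1] is the identity. *)
Section Proj.
Variable i : Rn.
Let robj (s : Rn) : vectType k := 'rV[k]_((i <= s)%O : bool).
Let rmap (s t : Rn) (st : (s <= t)%O) : 'Hom(robj s, robj t) :=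
  row_lfun (const_mx 1).
Let rmap_id (s : Rn) (ss : (s <= s)%O) : rmap ss = \1%VF.
Proof.
apply/lfunP => v; rewrite row_lfunE id_lfunE; move: v; rewrite /robj.
case: (i <= s)%O => v; last by rewrite [LHS]thinmx0 [RHS]thinmx0.
by apply/rowP => j; rewrite !ord1 mxE big_ord1 mxE mulr1.
Qed.
Let rmap_comp (s t u : Rn) (st : (s <= t)%O) (tu : (t <= u)%O)
  (su : (s <= u)%O) : rmap su = (rmap tu \o rmap st)%VF.
Proof.
apply/lfunP => v; rewrite comp_lfunE !row_lfunE.
rewrite -mulmxA; congr (_ *m _); apply/matrixP => a b.
have is_ : (i <= s)%O by move: a; case: (i <= s)%O => // -[].
rewrite !mxE (eq_bigr (fun=> 1)) => [|c _]; last by rewrite !mxE mulr1.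
by rewrite sumr_const card_ord (le_trans is_ st).
Qed.

Definition pproj : pmod := PMod rmap_id rmap_comp.
End Proj.

Definition pfree (I : seq Rn) : pmod :=
  foldr (fun i M => psum (pproj i) M) pzero I.

Definition is_cokernel (F G C : pmod) (f : pmor F G) (p : pmor G C) : Prop :=
  (forall s, (p s \o f s)%VF = 0) /\
  forall (N : pmod) (h : pmor G N), (forall s, (h s \o f s)%VF = 0) ->
    exists u : pmor C N, (forall s, (u s \o p s)%VF = h s) /\
      forall u' : pmor C N, (forall s, (u' s \o p s)%VF = h s) ->
        forall s, u' s = u s.

Definition finitely_presentable (M : pmod) : Prop :=
  exists (J I : seq Rn) (f : pmor (pfree J) (pfree I)) (p : pmor (pfree I) M),
    is_cokernel f p.

Lemma finitely_presentable_iso M N :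
  pisomorphic M N -> finitely_presentable M -> finitely_presentable N.
Proof.
move=> [a [b ab]] [J [I [f [p [pf0 pU]]]]].
exists J, I, f, (pmor_comp a p); split=> [s /=|P h hf0].
  by rewrite -comp_lfunA pf0 comp_lfun0r.
have [u [up uU]] := pU P h hf0.
exists (pmor_comp u b); split=> [s /=|u' u'p s /=].
  have [ba1 _] := ab s.
  by rewrite -comp_lfunA [X in (_ \o X)%VF]comp_lfunA ba1 comp_lfun1l up.
have [_ ab1] := ab s.
rewrite -(uU (pmor_comp u' a)) => [/=|t /=].
  by rewrite -comp_lfunA ab1 comp_lfun1r.
by rewrite -comp_lfunA; exact: u'p.
Qed.

Definition translate (s : Rn) (r : R) : Rn := fun i => s i + r.

Lemma translate_le (r : R) (s t : Rn) :
  (s <= t)%O -> (translate s r <= translate t r)%O.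
Proof. by move=> /asboolP st; apply/asboolP => i; rewrite lerD2r. Qed.

Definition strictly_trivial (e : R) (M : pmod) : Prop :=
  exists2 e' : R, 0 <= e' < e &
    forall (s : Rn) (h : (s <= translate s e')%O), pmap M h = 0.

Definition eps_indecomposable (e : R) (M : pmod) : Prop :=
  exists A T : pmod,
    [/\ pindecomposable A, strictly_trivial e T & pisomorphic M (psum A T)].

Section Shift.
Variables (M : pmod) (r : R).
Let sobj (s : Rn) : vectType k := M (translate s r).
Let smap (s t : Rn) (st : (s <= t)%O) : 'Hom(sobj s, sobj t) :=
  pmap M (translate_le r st).
Let smap_id (s : Rn) (ss : (s <= s)%O) : smap ss = \1%VF.
Proof. exact: pmap_id. Qed.
Let smap_comp (s t u : Rn) (st : (s <= t)%O) (tu : (t <= u)%O)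
  (su : (s <= u)%O) : smap su = (smap tu \o smap st)%VF.
Proof. exact: pmap_comp. Qed.

Definition pshift : pmod := PMod smap_id smap_comp.
End Shift.

(* The points [(s + e) + e] and [s + 2e] are equal but not convertible, so the
   triangle identities are stated with [M[e][e]] in place of [M[2e]]. *)
Definition interleaved (e : R) (M N : pmod) : Prop :=
  exists (f : pmor M (pshift N e)) (g : pmor N (pshift M e)),
    forall (s : Rn) (h : (s <= translate (translate s e) e)%O),
      (g (translate s e) \o f s)%VF = pmap M h /\
      (f (translate s e) \o g s)%VF = pmap N h.

Definition interleaving_dist (M N : pmod) : \bar R :=
  ereal_inf [set e%:E | e in [set e : R | 0 <= e /\ interleaved e M N]].

(* [pmod] quantifies over [vectType k] and is too large to carry a topological
   structure.  The points of the space are therefore represented by functors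
   into the skeleton of finite dimensional coordinate spaces;
   [class_repr_surj] and [class_repr_inj] show that they are exactly the
   isomorphism classes of finitely presentable modules. *)
Record cmod := CMod {
  cdim : Rn -> nat;
  cmap : forall s t : Rn, (s <= t)%O -> 'M[k]_(cdim s, cdim t);
  cmap_id : forall (s : Rn) (ss : (s <= s)%O), cmap ss = 1%:M;
  cmap_comp : forall (s t u : Rn) (st : (s <= t)%O) (tu : (t <= u)%O)
    (su : (s <= u)%O), cmap su = cmap st *m cmap tu
}.

Section PmodOfCmod.
Variable C : cmod.
Let cobj (s : Rn) : vectType k := 'rV[k]_(cdim C s).
Let clmap (s t : Rn) (st : (s <= t)%O) : 'Hom(cobj s, cobj t) :=
  row_lfun (cmap C st).
Let clmap_id (s : Rn) (ss : (s <= s)%O) : clmap ss = \1%VF.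
Proof. by apply/lfunP => v; rewrite row_lfunE cmap_id mulmx1 id_lfunE. Qed.
Let clmap_comp (s t u : Rn) (st : (s <= t)%O) (tu : (t <= u)%O)
  (su : (s <= u)%O) : clmap su = (clmap tu \o clmap st)%VF.
Proof.
by apply/lfunP => v; rewrite comp_lfunE !row_lfunE (cmap_comp C st tu) mulmxA.
Qed.

Definition pmod_of_cmod : pmod := PMod clmap_id clmap_comp.
End PmodOfCmod.

Section Skeleton.
Variable M : pmod.
Let d (s : Rn) : nat := dim (M s).
Let m (s t : Rn) (st : (s <= t)%O) : 'M[k]_(d s, d t) :=
  lin1_mx (v2r \o pmap M st \o @r2v k (M s)).
Let mE (s t : Rn) (st : (s <= t)%O) v : v *m m st = v2r (pmap M st (@r2v k (M s) v)).
Proof. exact: (mul_rV_lin1 (v2r \o pmap M st \o @r2v k (M s))). Qed.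
Let m_id (s : Rn) (ss : (s <= s)%O) : m ss = 1%:M.
Proof.
by apply/row_matrixP => i; rewrite !rowE mE pmap_id id_lfunE r2vK mulmx1.
Qed.
Let m_comp (s t u : Rn) (st : (s <= t)%O) (tu : (t <= u)%O)
  (su : (s <= u)%O) : m su = m st *m m tu.
Proof.
apply/row_matrixP => i; rewrite !rowE mulmxA !mE v2rK.
by rewrite (pmap_comp M st tu) comp_lfunE.
Qed.

Let f (s : Rn) : 'Hom(M s, pmod_of_cmod (CMod m_id m_comp) s) := linfun v2r.
Let g (s : Rn) : 'Hom(pmod_of_cmod (CMod m_id m_comp) s, M s) :=
  linfun (@r2v k (M s)).
Let fE (s : Rn) x : f s x = v2r x.
Proof. exact: (lfunE (@v2r k (M s))). Qed.
Let gE (s : Rn) x : g s x = @r2v k (M s) x.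
Proof. exact: (lfunE (@r2v k (M s))). Qed.

Lemma pmod_of_cmod_surj : exists C : cmod, pisomorphic M (pmod_of_cmod C).
Proof.
have fn (s t : Rn) (st : (s <= t)%O) : (f t \o pmap M st)%VF =
    (pmap (pmod_of_cmod (CMod m_id m_comp)) st \o f s)%VF.
  by apply/lfunP => x; rewrite !comp_lfunE row_lfunE !fE mE v2rK.
have gn (s t : Rn) (st : (s <= t)%O) :
    (g t \o pmap (pmod_of_cmod (CMod m_id m_comp)) st)%VF =
    (pmap M st \o g s)%VF.
  by apply/lfunP => x; rewrite !comp_lfunE row_lfunE !gE mE v2rK.
exists (CMod m_id m_comp), (PMor fn), (PMor gn) => s; split; apply/lfunP => x.
  by rewrite comp_lfunE id_lfunE gE fE v2rK.
by rewrite comp_lfunE id_lfunE fE gE r2vK.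
Qed.
End Skeleton.

Definition fpmod : Type :=
  {classic {C : cmod | finitely_presentable (pmod_of_cmod C)}}.

HB.instance Definition _ := Choice.on fpmod.

Definition fpmod_val (C : fpmod) : pmod := pmod_of_cmod (sval C).

Definition fpmod_iso : rel fpmod :=
  fun C D => `[< pisomorphic (fpmod_val C) (fpmod_val D) >].

Lemma fpmod_iso_equiv : equiv_class_of fpmod_iso.
Proof.
split=> [C|C D|D C E].
- exact/asboolP/pisomorphic_refl.
- by apply/asboolP/asboolP; exact: pisomorphic_sym.
- move=> /asboolP CD /asboolP DE; apply/asboolP.
  exact: (pisomorphic_trans CD DE).
Qed.

Canonical fpmod_iso_equiv_rel := EquivRelPack fpmod_iso_equiv.

Definition fpspace : Type := {eq_quot fpmod_iso}%qT.

HB.instance Definition _ := Choice.on fpspace.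

Definition class_repr (x : fpspace) : pmod :=
  fpmod_val (repr (x : {eq_quot fpmod_iso}%qT)).

Lemma class_repr_fp x : finitely_presentable (class_repr x).
Proof. exact: (svalP (repr (x : {eq_quot fpmod_iso}%qT))). Qed.

Lemma class_repr_surj M :
  finitely_presentable M -> exists x : fpspace, pisomorphic M (class_repr x).
Proof.
move=> Mfp; have [C MC] := pmod_of_cmod_surj M.
pose D : fpmod := exist _ C (finitely_presentable_iso MC Mfp).
exists (\pi_({eq_quot fpmod_iso}%qT) D).
apply: (pisomorphic_trans MC).
have : fpmod_iso D (repr (\pi_({eq_quot fpmod_iso}%qT) D)).
  by rewrite -eqmodE reprK.
by move/asboolP.
Qed.

Lemma class_repr_inj x y :
  pisomorphic (class_repr x) (class_repr y) -> x = y.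
Proof.
move=> /asboolP xy.
rewrite -[x](reprK (x : {eq_quot fpmod_iso}%qT)).
rewrite -[y](reprK (y : {eq_quot fpmod_iso}%qT)).
exact/eqmodP.
Qed.

Definition fpspace_dist (x y : fpspace) : \bar R :=
  interleaving_dist (class_repr x) (class_repr y).

Definition fpspace_ball (x : fpspace) (r : R) : set fpspace :=
  [set y | (fpspace_dist x y < r%:E)%E].

(* The subbase is the family of open balls, indexed by itself. *)
HB.instance Definition _ := @isSubBaseTopological.Build fpspace (set fpspace)
  [set B | exists x : fpspace, exists2 r : R, 0 < r & B = fpspace_ball x r] id.

Definition eps_indecomposables (e : R) : set fpspace :=
  [set x | eps_indecomposable e (class_repr x)].

End Modules.

(* Main.v *)
Require Import Defs.
From HB Require Import structures.
From mathcomp Require Import all_boot all_order all_algebra.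
From mathcomp Require Import all_classical all_reals all_analysis.
From mathcomp Require Import finmap ring lra.

(* Open: let M = A + T with A indecomposable and T strictly trivial.  For small r,
   the maps M(s) -> M(s + 2r) are bijective at the grades s of a presentation of
   M, so an r-interleaving turns endomorphisms of N into endomorphisms of M,
   additively.  End(A) is local by Fitting's lemma, hence an idempotent of N of
   minimal rank among those whose lift is invertible on A has an indecomposable
   image; the complementary summand is trivial because A splits off its
   complement in M.

   Dense: in a presentation with generators of distinct grades, an endomorphism
   is triangular; its diagonal entries at two generators agree as soon as both
   are pivots of one relation.  Any module is approximated by one whose
   generators are all linked in this way: each generator is replaced by two, whose
   difference is tied, through slabs that are thin in one coordinate only, to one
   element common to all of them. *)

Set Implicit Arguments.
Unset Strict Implicit.
Unset Printing Implicit Defensive.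

Import Order.TTheory GRing.Theory Num.Theory.
Import VectorInternalTheory Defs.
Local Open Scope ring_scope.

(** Openness: the radius depends on M and the trivial summand but not on N, which is arbitrary.
    Endomorphisms are therefore moved from N to M, and only M has to be stable under small shifts.
    Density: a relation equating a generator with a short-lived element would kill the generator as
    well, and one equating two generators of M would change M too much. Splitting each generator
    avoids both: only the difference of the two copies is equated with something short-lived, so
    beyond the slab the copies coincide and the old generator is back. The relations tying the slabs
    to the common element must have pairwise incomparable grades, since otherwise a multiple of one
    could correct the coefficients of another and the diagonal entries would not be forced to agree.
    Such an antichain needs two coordinates; this is where n >= 2 enters. *)

Section LinearAlgebra.
Variable k : fieldType.

Lemma linear_lfun (U V : vectType k) (f : U -> V) :
  linear f -> {g : 'Hom(U, V) | g =1 f}.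
Proof.
move=> fL.
pose F : {linear U -> V} := HB.pack f (GRing.isLinear.Build k U V _ f fL).
by exists (linfun F) => x; rewrite (lfunE F).
Qed.

(** The quotient has to be a [vectType] again; the complement of [U] serves as a model of it. *)
Lemma quotient_lfun (V : vectType k) (U : {vspace V}) :
  {Q : vectType k & {r : 'Hom(V, Q) | limg r = fullv /\ lker r = U}}.
Proof.
have [|pi piE] := @linear_lfun V (subvs_of (U^C)%VS)
  (fun x => vsproj (U^C) (x - projv U x)).
  by move=> a x y; rewrite -linearP; congr vsproj; rewrite linearP scalerBr opprD addrACA.
exists (subvs_of (U^C)%VS), pi; split.
  apply/eqP; rewrite eqEsubv subvf /=; apply/subvP => y _.
  apply/memv_imgP; exists (vsval y); rewrite ?memvf // piE.
  have /eqP -> : projv U (vsval y) == 0 by rewrite -memv_ker lker_proj subvsP.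
  by rewrite subr0 vsvalK.
apply/vspaceP => x; rewrite memv_ker piE; apply/eqP/idP => [h|xU].
  have : vsval (vsproj (U^C) (x - projv U x)) = 0 by rewrite h linear0.
  rewrite vsprojK ?memv_projC // => /eqP; rewrite subr_eq0 => /eqP ->.
  exact: memv_proj.
by rewrite projv_id // subrr linear0.
Qed.

End LinearAlgebra.

(** * Presentations by graded generators and relations *)

Section Presentations.
Variables (R : realType) (k : fieldType) (n : nat).
Local Notation Rn := ('I_n -> R).
Local Notation pmod := (pmod R k n).
Implicit Types (M N P : pmod) (s t u : Rn).

(* The structure map from [s] to [t], extended by [0] when [s <= t] fails. *)
Definition tr M s t : 'Hom(M s, M t) :=
  match boolP (s <= t)%O with
  | AltTrue h => pmap M h
  | AltFalse _ => 0
  end.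

Lemma trE M s t (h : (s <= t)%O) : tr M s t = pmap M h.
Proof.
rewrite /tr; case: {-}_ / boolP => [h'|]; last by rewrite h.
by rewrite (eq_irrelevance h h').
Qed.

Lemma tr0 M s t : ~~ (s <= t)%O -> tr M s t = 0.
Proof. by move=> st; rewrite /tr; case: {-}_ / boolP => // h; rewrite h in st. Qed.

Lemma tr_id M s x : tr M s s x = x.
Proof. by rewrite (trE M (lexx s)) pmap_id id_lfunE. Qed.

Lemma tr_tr M s t u x : (s <= t)%O -> (t <= u)%O ->
  tr M t u (tr M s t x) = tr M s u x.
Proof.
move=> st tu; have su := le_trans st tu.
by rewrite (trE M st) (trE M tu) (trE M su) (pmap_comp M st tu) comp_lfunE.
Qed.

Lemma pmor_tr M N (f : pmor M N) s t x : f t (tr M s t x) = tr N s t (f s x).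
Proof.
have [st|st] := boolP (s <= t)%O; last by rewrite !tr0 // !lfunE /= linear0.
by have /lfunP/(_ x) := pmor_nat f st; rewrite !comp_lfunE !(trE _ st).
Qed.

Lemma build_pmor M N (f : forall s, 'Hom(M s, N s)) :
  (forall s t x, (s <= t)%O -> f t (tr M s t x) = tr N s t (f s x)) ->
  {g : pmor M N | forall s, g s = f s}.
Proof.
move=> fn; unshelve eexists (@PMor R k n M N f _) => // s t st.
by apply/lfunP => x; rewrite !comp_lfunE -!trE fn.
Qed.

(* The value in [M s] of a formal combination of elements [x g] of [M (p g)]:
   terms whose grade is not below [s] count as [0]. *)
Definition ev M (G : finType) (p : G -> Rn) (x : forall g, M (p g)) s
  (c : G -> k) : M s := \sum_g c g *: tr M (p g) s (x g).

Section Ev.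
Variables (M : pmod) (G : finType) (p : G -> Rn) (x : forall g, M (p g)).

(** Without the support condition, a generator with grade below [t] but not below [s] would count on
    the right only. *)
Lemma tr_ev s t c : (forall g, c g != 0 -> (p g <= s)%O) -> (s <= t)%O ->
  tr M s t (ev x s c) = ev x t c.
Proof.
move=> cs st; rewrite linear_sum; apply: eq_bigr => g _; rewrite linearZ /=.
by have [->|/cs ps] := eqVneq (c g) 0; rewrite ?scale0r // tr_tr.
Qed.

Lemma ev_mask s c :
  ev x s (fun g => if (p g <= s)%O then c g else 0) = ev x s c.
Proof.
apply: eq_bigr => g _; case: ifPn => // ps.
by rewrite tr0 // lfunE /= !scaler0.
Qed.

Lemma eq_ev s c c' : (forall g, (p g <= s)%O -> c g = c' g) ->
  ev x s c = ev x s c'.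
Proof.
move=> cc'; apply: eq_bigr => g _; have [/cc'->//|ps] := boolP (p g <= s)%O.
by rewrite tr0 // lfunE /= !scaler0.
Qed.

Lemma ev_lin s a c c' :
  ev x s (fun g => a * c g + c' g) = a *: ev x s c + ev x s c'.
Proof.
rewrite scaler_sumr -big_split; apply: eq_bigr => g _ /=.
by rewrite scalerDl scalerA.
Qed.

Lemma ev_sum s (H : finType) (d : H -> k) (F : H -> G -> k) :
  ev x s (fun g => \sum_h d h * F h g) = \sum_h d h *: ev x s (F h).
Proof.
rewrite /ev; under eq_bigr do rewrite scaler_suml.
rewrite exchange_big; apply: eq_bigr => h _; rewrite scaler_sumr.
by apply: eq_bigr => g _; rewrite scalerA.
Qed.

Lemma evB s c c' : ev x s (fun g => c g - c' g) = ev x s c - ev x s c'.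
Proof. by rewrite -sumrB; apply: eq_bigr => g _; rewrite scalerBl. Qed.

Lemma ev_delta s g : ev x s (fun h => (h == g)%:R) = tr M (p g) s (x g).
Proof.
rewrite /ev (bigD1 g) //= eqxx scale1r big1 ?addr0 // => h /negbTE ->.
by rewrite scale0r.
Qed.

Lemma ev_lfun s : {f : 'Hom({ffun G -> k^o}, M s) | forall c, f c = ev x s c}.
Proof.
apply: linear_lfun => a c c'; rewrite -ev_lin; apply: eq_ev => g _.
by rewrite !ffunE.
Qed.

End Ev.

Lemma pmor_ev M N (f : pmor M N) (G : finType) (p : G -> Rn)
    (x : forall g, M (p g)) s c :
  f s (ev x s c) = ev (fun g => f (p g) (x g)) s c.
Proof.
by rewrite linear_sum; apply: eq_bigr => g _; rewrite linearZ /= pmor_tr.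
Qed.

(** Grade-by-grade substitute for the universal property of a cokernel: the linear relations at [s]
    are spanned by the relations of grade at most [s]. Coefficients of generators not below [s] stay
    free in [pres_rel], since [ev] ignores them. *)
Record presents M (G H : finType) (p : G -> Rn) (q : H -> Rn) (F : H -> G -> k)
    (x : forall g, M (p g)) : Prop := Presents {
  pres_hom : forall h g, F h g != 0 -> (p g <= q h)%O;
  pres_gen : forall s (y : M s), exists c, y = ev x s c;
  pres_rel : forall s c, ev x s c = 0 <->
    exists2 d : H -> k, (forall h, d h != 0 -> (q h <= s)%O) &
      forall g, (p g <= s)%O -> c g = \sum_h d h * F h g
}.

Section PresentedModules.
Variables (M : pmod) (G H : finType) (p : G -> Rn) (q : H -> Rn).
Variables (F : H -> G -> k) (x : forall g, M (p g)).
Hypothesis pr : presents q F x.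

Lemma pres_rel0 h : ev x (q h) (F h) = 0.
Proof.
apply/(pres_rel pr); exists (fun h' => (h' == h)%:R) => [h'|g _].
  by case: (eqVneq h' h) => [->|_] //=; rewrite eqxx.
rewrite (bigD1 h) //= eqxx mul1r big1 ?addr0 // => i /negbTE ->.
by rewrite mul0r.
Qed.

Lemma pres_gen_supp s (y : M s) : exists2 c,
  (forall g, c g != 0 -> (p g <= s)%O) & y = ev x s c.
Proof.
have [c yE] := pres_gen pr y.
exists (fun g => if (p g <= s)%O then c g else 0); last by rewrite ev_mask.
by move=> g; case: ifP; rewrite ?eqxx.
Qed.

Lemma pmor_gen_ext N (u v : pmor M N) :
  (forall g, u (p g) (x g) = v (p g) (x g)) -> forall s, u s = v s.
Proof.
move=> uv s; apply/lfunP => y; have [c ->] := pres_gen pr y.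
rewrite !pmor_ev; apply: eq_bigr => g _; congr (_ *: _).
by rewrite uv.
Qed.

(** At each grade, evaluation on [x] is onto and its kernel lies in that of evaluation on [y], so
    the latter descends to [M]. *)
Lemma pres_pmor N (y : forall g, N (p g)) :
  (forall h, ev y (q h) (F h) = 0) ->
  exists u : pmor M N, forall g, u (p g) (x g) = y g.
Proof.
move=> y0.
have yE s c : ev x s c = 0 -> ev y s c = 0.
  move=> /(pres_rel pr)[d dq cE]; rewrite (eq_ev _ cE) ev_sum big1 // => h _.
  have [->|/dq qs] := eqVneq (d h) 0; first by rewrite scale0r.
  by rewrite -(tr_ev y (pres_hom pr (h := h)) qs) y0 linear0 scaler0.
pose a s := sval (ev_lfun x s); pose b s := sval (ev_lfun y s).
have aE s c : a s c = ev x s c by rewrite /a; case: ev_lfun.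
have bE s c : b s c = ev y s c by rewrite /b; case: ev_lfun.
have aI s z : z \in limg (a s).
  have [c ->] := pres_gen pr z; apply/memv_imgP; exists [ffun g => c g].
    exact: memvf.
  by rewrite aE; apply: eq_ev => g _; rewrite ffunE.
(* [(a s)^-1] is only some section of the surjection [a s]; by [yE] the choice does not affect the
   value. *)
have uE s c : (b s \o (a s)^-1)%VF (ev x s c) = ev y s c.
  rewrite comp_lfunE /= bE; apply/eqP; rewrite -subr_eq0 -evB; apply/eqP/yE.
  by rewrite evB -aE limg_lfunVK ?aI // subrr.
have [|u uD] := @build_pmor M N (fun s => b s \o (a s)^-1)%VF.
  move=> s t z st; have [c cs ->] := pres_gen_supp z.
  rewrite (tr_ev x cs st) !uE tr_ev //.
exists u => g; rewrite uD -[x g]tr_id -ev_delta uE ev_delta tr_id //.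
Qed.

End PresentedModules.
End Presentations.

(** * Finitely presentable modules and presentations *)

Section Cokernels.
Variables (R : realType) (k : fieldType) (n : nat).
Local Notation Rn := ('I_n -> R).
Local Notation pmod := (pmod R k n).
Implicit Types (M N P : pmod) (s t u : Rn).

Lemma pointwise_coker M N (f : pmor M N) :
  exists C : pmod, exists r : pmor N C,
    forall s, limg (r s) = fullv /\ lker (r s) = limg (f s).
Proof.
pose Q s := projT1 (quotient_lfun (limg (f s))).
pose r s : 'Hom(N s, Q s) := sval (projT2 (quotient_lfun (limg (f s)))).
have rI s : limg (r s) = fullv by have [] := svalP (projT2 (quotient_lfun (limg (f s)))).
have rK s : lker (r s) = limg (f s) by have [] := svalP (projT2 (quotient_lfun (limg (f s)))).
have rV s z : r s ((r s)^-1%VF z) = z by rewrite limg_lfunVK // rI memvf.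
have r0 s z : r s z = 0 <-> exists y, z = f s y.
  split=> [/eqP|[y ->]]; first by rewrite -memv_ker rK => /memv_imgP[y _ ->]; exists y.
  by apply/eqP; rewrite -memv_ker rK memv_img ?memvf.
(* Replacing [z] by its chosen representative changes it by an element of the image of [f], which
   structure maps preserve and [r] kills. Hence the quotients are functorial. *)
have key s t z : r t (tr N s t ((r s)^-1%VF (r s z))) = r t (tr N s t z).
  have /r0[y yE] : r s ((r s)^-1%VF (r s z) - z) = 0 by rewrite linearB /= rV subrr.
  apply/eqP; rewrite -subr_eq0; apply/eqP.
  transitivity (r t (tr N s t ((r s)^-1%VF (r s z) - z))); first by rewrite !linearB.
  by rewrite yE -pmor_tr; apply/r0; exists (tr M s t y).
pose m s t (st : (s <= t)%O) : 'Hom(Q s, Q t) := (r t \o tr N s t \o (r s)^-1)%VF.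
have mid s (ss : (s <= s)%O) : m s s ss = \1%VF.
  by apply/lfunP => z; rewrite !comp_lfunE tr_id rV id_lfunE.
have mcomp s t u (st : (s <= t)%O) (tu : (t <= u)%O) (su : (s <= u)%O) :
    m s u su = (m t u tu \o m s t st)%VF.
  by apply/lfunP => z; rewrite !comp_lfunE key tr_tr.
exists (PMod mid mcomp).
have [|g gE] := @build_pmor _ _ _ N (PMod mid mcomp) r.
  by move=> s t z st; rewrite (trE (PMod mid mcomp) st) /= !comp_lfunE key.
by exists g => s; rewrite gE rI rK.
Qed.

Lemma pointwise_is_coker M N C (f : pmor M N) (r : pmor N C) :
  (forall s, limg (r s) = fullv /\ lker (r s) = limg (f s)) -> is_cokernel f r.
Proof.
move=> rIK.
have rV s z : r s ((r s)^-1%VF z) = z by rewrite limg_lfunVK // (rIK s).1 memvf.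
have rf s : (r s \o f s)%VF = 0.
  apply/lfunP => x; rewrite comp_lfunE lfunE /=; apply/eqP.
  by rewrite -memv_ker (rIK s).2 memv_img ?memvf.
split=> // P h hf.
have h0 s z : r s z = 0 -> h s z = 0.
  move=> /eqP; rewrite -memv_ker (rIK s).2 => /memv_imgP[y _ ->].
  by rewrite -comp_lfunE hf lfunE.
have hr s z : h s ((r s)^-1%VF (r s z)) = h s z.
  by apply/eqP; rewrite -subr_eq0 -linearB; apply/eqP/h0; rewrite linearB /= rV subrr.
have [|u uE] := @build_pmor _ _ _ C P (fun s => h s \o (r s)^-1)%VF.
  move=> s t z st; rewrite !comp_lfunE -{1}[z]rV -pmor_tr hr.
  by rewrite pmor_tr.
exists u; split=> [s|u' u'E s].
  by apply/lfunP => x; rewrite uE !comp_lfunE hr.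
by rewrite uE -u'E; apply/lfunP => x; rewrite !comp_lfunE rV.
Qed.

(** The pointwise quotient is a cokernel too, and cokernels are unique up to isomorphism, so its
    exactness carries over to [r]. *)
Lemma coker_pointwise M N C (f : pmor M N) (r : pmor N C) :
  is_cokernel f r -> forall s, limg (r s) = fullv /\ lker (r s) = limg (f s).
Proof.
move=> [rf rU].
have [D [p pIK]] := pointwise_coker f.
have [pf pU] := pointwise_is_coker pIK.
have [u [up _]] := rU D p pf; have [w [wp _]] := pU C r rf.
have [i [ip iU]] := rU C r rf.
have wu s x : w s (u s x) = x.
  have E1 : forall t, (pmor_comp w u t \o r t)%VF = r t.
    by move=> t; rewrite -comp_lfunA up wp.
  have E2 : forall t, (pmor_id C t \o r t)%VF = r t by move=> t; rewrite comp_lfun1l.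
  have := iU _ E1 s; rewrite -(iU _ E2 s) => /lfunP/(_ x).
  by rewrite comp_lfunE id_lfunE.
move=> s; split.
  apply/eqP; rewrite eqEsubv subvf; apply/subvP => y _.
  have /memv_imgP[z _ uyE] : u s y \in limg (p s) by rewrite (pIK s).1 memvf.
  by rewrite -[y]wu uyE -comp_lfunE wp memv_img ?memvf.
apply/eqP; rewrite eqEsubv; apply/andP; split; apply/subvP => y.
  rewrite memv_ker -(pIK s).2 memv_ker => /eqP ry.
  by rewrite -up comp_lfunE ry linear0.
move=> /memv_imgP[z _ ->]; rewrite memv_ker -comp_lfunE rf lfunE /=.
by rewrite eqxx.
Qed.

Definition free_gens M (G : finType) (p : G -> Rn) (x : forall g, M (p g)) :=
  (forall s (y : M s), exists c, y = ev x s c) /\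
  (forall s c, ev x s c = 0 -> forall g, (p g <= s)%O -> c g = 0).

Lemma free_gens_presents M (G : finType) (p : G -> Rn) (x : forall g, M (p g)) :
  free_gens x -> presents (fun h : void => match h with end)
    (fun h : void => match h with end) x.
Proof.
move=> [xg xf]; split=> [|//|s c]; first (by case); split=> [c0|[d _ cE]].
  exists (fun _ => 0) => [[]|g ps]; rewrite big1; last by case.
  exact: xf c0 g ps.
rewrite (eq_ev x (c' := fun=> 0)) => [|g ps].
  by rewrite /ev big1 // => g _; rewrite scale0r.
by rewrite cE // big1 // => -[].
Qed.

Lemma tr_psum M N s t x y :
  tr (psum M N) s t (x, y) = (tr M s t x, tr N s t y).
Proof.
have [st|st] := boolP (s <= t)%O; last by rewrite !tr0 // !lfunE.
by rewrite !(trE _ st) pair_lfunE.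
Qed.

Lemma tr_pproj (i s : Rn) : (i <= s)%O ->
  tr (pproj k i) i s (const_mx 1) = const_mx 1.
Proof.
move=> is_; rewrite (trE _ is_) row_lfunE; apply/rowP => j; rewrite !mxE.
rewrite (eq_bigr (fun=> 1)) => [|l _]; last by rewrite !mxE mulr1.
by rewrite sumr_const card_ord lexx.
Qed.

Lemma pproj_gen (i s : Rn) (y : pproj k i s) :
  exists a, y = a *: tr (pproj k i) i s (const_mx 1).
Proof.
(* The dimension is a boolean that occurs in types; it is generalised so that it can be
   destructed. *)
have aux (b : bool) (v w : 'rV[k]_b) : (b -> w = const_mx 1) -> exists a, v = a *: w.
  case: b v w => v w; last by exists 0; rewrite [LHS]thinmx0 [RHS]thinmx0.
  move=> -> //; exists (v 0 0); apply/rowP => j.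
  by rewrite !ord1 !mxE mulr1.
apply: aux; exact: tr_pproj.
Qed.

Lemma pproj_gen_inj (i s : Rn) a : (i <= s)%O ->
  a *: tr (pproj k i) i s (const_mx 1) = 0 -> a = 0.
Proof.
move=> is_; rewrite tr_pproj //.
have aux (b : bool) : b -> a *: (const_mx 1 : 'rV[k]_b) = 0 -> a = 0.
  by case: b => // _ /rowP/(_ 0); rewrite !mxE mulr1.
exact: aux.
Qed.

Lemma pfree_gens (G : finType) (p : G -> Rn) :
  exists x : forall g, pfree k (map p (enum G)) (p g), free_gens x.
Proof.
(* A version of [ev] over a list, so that the induction follows the [foldr] in [pfree]. *)
pose T l (x : forall g, pfree k (map p l) (p g)) s (c : G -> k) :=
  \sum_(g <- l) c g *: tr _ (p g) s (x g).
suff H : forall l, uniq l -> exists x : forall g, pfree k (map p l) (p g),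
    (forall s y, exists c, y = T l x s c) /\
    (forall s c, T l x s c = 0 -> forall g, g \in l -> (p g <= s)%O -> c g = 0).
  have [x [xg xf]] := H _ (enum_uniq G); exists x.
  have TE s c : T (enum G) x s c = ev x s c by rewrite /T big_enum.
  split=> [s y|s c]; first by have [c ->] := xg s y; exists c; rewrite TE.
  by rewrite -TE => /xf h g; apply: h; rewrite mem_enum.
elim=> [_|g0 l IHl /andP[g0l ul]].
  exists (fun=> 0); split=> // s y; exists (fun=> 0).
  by rewrite /T big_nil [LHS]thinmx0.
have [x [xg xf]] := IHl ul.
(* The test [g == g0] does not refine types, so the constant row is written at the grade [p g]; it
   is the generator of the new summand when [g] is [g0]. *)
pose x' g : pfree k (map p (g0 :: l)) (p g) := 
  (if g == g0 then const_mx 1 : pproj k (p g0) (p g) else 0,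
   if g == g0 then 0 else x g).
have sE s c : T (g0 :: l) x' s c =
    (c g0 *: tr (pproj k (p g0)) (p g0) s (const_mx 1), T l x s c).
  rewrite /T big_cons /x' eqxx tr_psum linear0.
  transitivity ((c g0 *: tr (pproj k (p g0)) (p g0) s (const_mx 1), 0) +
    (0, T l x s c) : psum (pproj k (p g0)) (pfree k (map p l)) s); last first.
    by congr pair; rewrite ?addr0 ?add0r.
  congr (_ + _); first by congr pair; rewrite scaler0.
  rewrite big_seq_cond /T [X in (_, X)]big_seq_cond.
  apply: (big_rec2 (fun (u : psum _ _ s) v => u = (0, v))) => // g u v.
  rewrite andbT => gl ->.
  case: eqVneq gl => [->|_ _]; first by rewrite (negbTE g0l).
  by rewrite tr_psum linear0; congr pair; rewrite /= ?scaler0 ?addr0.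
exists x'; split=> [s [y1 y2]|s c].
  have [a ->] := pproj_gen y1; have [c ->] := xg s y2.
  exists (fun g => if g == g0 then a else c g); rewrite sE eqxx; congr pair.
  apply: eq_big_seq => g gl; case: eqVneq gl => // ->.
  by rewrite (negbTE g0l).
rewrite sE => -[h1 h2] g; rewrite inE => /predU1P[->|gl] ps.
  exact: pproj_gen_inj h1.
exact: xf h2 _ gl ps.
Qed.

Section PresentsCoker.
Variables (E D M : pmod) (G H : finType) (p : G -> Rn) (q : H -> Rn).
Variables (x : forall g, E (p g)) (y : forall h, D (q h)) (F : H -> G -> k).
Variables (f : pmor D E) (r : pmor E M).
Hypotheses (xfree : free_gens x) (ygen : free_gens y).
Hypothesis F_hom : forall h g, F h g != 0 -> (p g <= q h)%O.
Hypothesis fE : forall h, f (q h) (y h) = ev x (q h) (F h).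
Hypothesis rIK : forall s, limg (r s) = fullv /\ lker (r s) = limg (f s).

Lemma presents_coker : presents q F (fun g => r (p g) (x g)).
Proof.
have fev s d : (forall h, d h != 0 -> (q h <= s)%O) ->
    f s (ev y s d) = ev x s (fun g => \sum_h d h * F h g).
  move=> ds; rewrite pmor_ev ev_sum; apply: eq_bigr => h _.
  have [->|/ds qs] := eqVneq (d h) 0; first by rewrite !scale0r.
  by rewrite fE tr_ev // => g; apply: F_hom.
split=> // [s z|s c].
  have /memv_imgP[w _ ->] : z \in limg (r s) by rewrite (rIK s).1 memvf.
  have [c ->] := xfree.1 s w; exists c; exact: pmor_ev.
rewrite -pmor_ev; split=> [/eqP|[d ds cE]].
  rewrite -memv_ker (rIK s).2 => /memv_imgP[z _].
  have [d0 ->] := ygen.1 s z; rewrite -(ev_mask y).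
  (* Relations not yet born at [s] are masked: they evaluate to 0 in [D], but [pres_rel] asks for
     coefficients supported below [s]. *)
  pose d h := if (q h <= s)%O then d0 h else 0; rewrite -/d.
  have ds h : d h != 0 -> (q h <= s)%O by rewrite /d; case: ifP; rewrite ?eqxx.
  rewrite fev // => /eqP; rewrite -subr_eq0 -evB => /eqP/xfree.2 cE.
  by exists d => // g /cE/eqP; rewrite subr_eq0 => /eqP.
apply/eqP; rewrite -memv_ker (rIK s).2 (eq_ev x cE) -fev //.
by rewrite memv_img ?memvf.
Qed.

End PresentsCoker.

Lemma fp_presents M : finitely_presentable M ->
  exists (G H : finType) (p : G -> Rn) (q : H -> Rn) (F : H -> G -> k)
    (x : forall g, M (p g)), presents q F x.
Proof.
have famE (I : seq Rn) : exists (G : finType) (p : G -> Rn), I = map p (enum G).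
  exists 'I_(size I), (tnth (in_tuple I)).
  by rewrite map_tnth_enum.
move=> [J [I [f [r rc]]]].
have [G [p IE]] := famE I; have [H [q JE]] := famE J.
subst I J; have [x xfree] := pfree_gens p; have [y yfree] := pfree_gens q.
have /choice[F0 F0E] : forall h, exists c, f (q h) (y h) = ev x (q h) c.
  by move=> h; exact: xfree.1.
exists G, H, p, q, (fun h g => if (p g <= q h)%O then F0 h g else 0).
exists (fun g => r (p g) (x g)).
apply: (presents_coker (E := pfree k (map p (enum G)))
  (D := pfree k (map q (enum H))) xfree yfree (f := f)).
- by move=> h g; case: ifP; rewrite ?eqxx.
- by move=> h; rewrite ev_mask.
- exact: coker_pointwise rc.
Qed.

(** Allows a module to be constructed by writing down grades and a matrix, as is done for the
    approximating module. *)
Lemma presents_fp (G H : finType) (p : G -> Rn) (q : H -> Rn) (F : H -> G -> k) :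
  (forall h g, F h g != 0 -> (p g <= q h)%O) ->
  exists M, finitely_presentable M /\ exists x : forall g, M (p g), presents q F x.
Proof.
move=> F_hom.
have [x xfree] := pfree_gens p; have [y yfree] := pfree_gens q.
have [|f fE] := pres_pmor (free_gens_presents yfree)
  (y := fun h => ev x (q h) (F h)); first by case.
have [M [r rIK]] := pointwise_coker f.
exists M; split.
  exists (map q (enum H)), (map p (enum G)), f, r; exact: pointwise_is_coker.
exists (fun g => r (p g) (x g)).
exact: (presents_coker xfree yfree F_hom fE rIK).
Qed.

End Cokernels.

(** * Fitting decomposition of a linear endomorphism *)

Section Fitting.
Variables (k : fieldType) (V : vectType k) (f : 'End(V)).

(** [e] is the projection onto the stable image of [f] along its stable kernel. The properties
    mention only iterates of [f], so linear maps commuting with the endomorphisms transport them;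
    this gives naturality for modules. *)
Lemma fitting_lfun : exists (e : 'End(V)) (K : nat), [/\
  forall x, iter K f (x - e x) = 0,
  forall x j, exists y, e x = iter j f y,
  forall x j, iter j f x = 0 -> e x = 0 &
  forall x, (forall j, exists y, x = iter j f y) -> e x = x].
Proof.
pose pw j : 'End(V) := iter j (fun g => (f \o g)%VF) \1%VF.
have pwE j x : pw j x = iter j f x.
  by elim: j => [|j IHj]; rewrite /= ?id_lfunE // comp_lfunE IHj.
(* From the exponent of minimal rank on, the images are stationary, and by rank-nullity the kernels
   are too. *)
have [K0 _ Kmin] : exists2 j, True & forall i, (\dim (limg (pw j)) <= \dim (limg (pw i)))%N.
  have ex : exists d, `[< exists j, \dim (limg (pw j)) = d >].
    by exists (\dim (limg (pw 0))); apply/asboolP; exists 0.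
  have := ex_minnP ex; case=> d /asboolP[j jd] dmin; exists j => // i.
  by rewrite jd; apply: dmin; apply/asboolP; exists i.
have subI i j : (i <= j)%N -> (limg (pw j) <= limg (pw i))%VS.
  move=> ij; apply/subvP => _ /memv_imgP[x _ ->].
  rewrite pwE -(subnKC ij) iterD -!pwE memv_img ?memvf //.
have subK i j : (i <= j)%N -> (lker (pw i) <= lker (pw j))%VS.
  move=> ij; apply/subvP => x; rewrite !memv_ker !pwE -(subnK ij) iterD.
  by move=> /eqP ->; rewrite -pwE linear0.
have dimE j : (\dim (lker (pw j)) + \dim (limg (pw j)) = \dim {:V})%N.
  by rewrite -[RHS](limg_ker_dim (pw j)) capfv.
have eqI j : limg (pw (K0 + j)%N) = limg (pw K0).
  by apply/eqP; rewrite eqEdim subI ?leq_addr // Kmin.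
have eqK j : lker (pw (K0 + j)%N) = lker (pw K0).
  apply/esym/eqP; rewrite eqEdim subK ?leq_addr //=.
  have := dimE (K0 + j)%N; rewrite eqI -(dimE K0) => /eqP.
  by rewrite eqn_add2r => /eqP ->.
pose U := limg (pw K0); pose W := lker (pw K0).
have UW : (U :&: W = 0)%VS.
  apply/eqP; rewrite -subv0; apply/subvP => x; rewrite memv_cap memv0.
  move=> /andP[/memv_imgP[y _ ->]]; rewrite memv_ker !pwE -iterD -pwE -memv_ker.
  by rewrite eqK memv_ker pwE.
have UWf : (U + W)%VS = fullv.
  by apply/eqP; rewrite eqEdim subvf /= dimv_disjoint_sum // addnC dimE.
have UWD x : daddv_pi U W x + daddv_pi W U x = x.
  by apply: daddv_pi_add; rewrite // UWf memvf.
exists (daddv_pi U W), K0; split=> [x|x j|x j xj|x xI].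
- rewrite -{1}(UWD x) addrC addrA addNr add0r; apply/eqP.
  by rewrite -pwE -memv_ker memv_pi.
- have : daddv_pi U W x \in limg (pw j).
    by apply: (subvP (subI _ _ (leq_addl K0 j))); rewrite eqI memv_pi.
  by move=> /memv_imgP[y _ ->]; exists y; rewrite pwE.
- have xW : x \in W.
    rewrite /W -(eqK j); apply: (subvP (subK _ _ (leq_addl K0 j))).
    by rewrite memv_ker pwE xj.
  have WU : (W :&: U = 0)%VS by rewrite capvC.
  have := UWD x; rewrite (daddv_pi_id (V := U) (U := W)) // => /eqP.
  by rewrite -subr_eq0 addrK => /eqP.
- apply: daddv_pi_id => //; have [y ->] := xI K0.
  by rewrite -pwE memv_img ?memvf.
Qed.

End Fitting.

(** * Direct summands, idempotents and local endomorphism rings *)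

Section Idempotents.
Variables (R : realType) (k : fieldType) (n : nat).
Local Notation Rn := ('I_n -> R).
Local Notation pmod := (pmod R k n).
Implicit Types (M N P A B : pmod) (s t u : Rn).

Lemma build_pmor_fun M N (f : forall s, M s -> N s) :
  (forall s, linear (f s)) ->
  (forall s t x, (s <= t)%O -> f t (tr M s t x) = tr N s t (f s x)) ->
  exists g : pmor M N, forall s x, g s x = f s x.
Proof.
move=> fL fN; pose h s := sval (linear_lfun (fL s)).
have hE s x : h s x = f s x by rewrite /h; case: linear_lfun.
have [|g gE] := @build_pmor _ _ _ M N h; first by move=> *; rewrite !hE fN.
by exists g => s x; rewrite gE.
Qed.

Definition pidempotent M (e : pmor M M) := forall s x, e s (e s x) = e s x.

Lemma compl_idempotent M (e : pmor M M) : pidempotent e ->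
  exists e' : pmor M M, pidempotent e' /\ forall s x, e' s x = x - e s x.
Proof.
move=> ee; have [||e' e'E] := @build_pmor_fun M M (fun s x => x - e s x).
- by move=> s a x y; rewrite linearP scalerBr opprD addrACA.
- by move=> s t x st; rewrite pmor_tr linearB.
exists e'; split=> // s x.
by rewrite !e'E [e s (_ - _)]linearB /= ee subrr subr0.
Qed.

Lemma split_idempotent M (e : pmor M M) : pidempotent e ->
  exists (A : pmod) (i : pmor A M) (p : pmor M A),
    (forall s x, p s (i s x) = x) /\ (forall s x, i s (p s x) = e s x).
Proof.
move=> ee; pose U s := limg (e s); pose Q s : vectType k := subvs_of (U s).
have trU s t (x : Q s) : tr M s t (vsval x) \in U t.
  have /memv_imgP[y _ ->] := subvsP x.
  by rewrite -pmor_tr memv_img ?memvf.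
have eU s (x : Q s) : e s (vsval x) = vsval x.
  by have /memv_imgP[y _ ->] := subvsP x; rewrite ee.
have mL s t : linear (fun x : Q s => vsproj (U t) (tr M s t (vsval x))).
  by move=> a x y; rewrite !linearP.
pose m s t (st : (s <= t)%O) : 'Hom(Q s, Q t) := sval (linear_lfun (mL s t)).
have mE s t st x : m s t st x = vsproj (U t) (tr M s t (vsval x)).
  by rewrite /m; case: linear_lfun.
have mid s (ss : (s <= s)%O) : m s s ss = \1%VF.
  by apply/lfunP => z; rewrite mE tr_id vsvalK id_lfunE.
have mcomp s t u (st : (s <= t)%O) (tu : (t <= u)%O) (su : (s <= u)%O) :
    m s u su = (m t u tu \o m s t st)%VF.
  by apply/lfunP => z; rewrite comp_lfunE !mE vsprojK ?trU // tr_tr.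
pose A := PMod mid mcomp.
have trA s t (x : A s) : tr A s t x = vsproj (U t) (tr M s t (vsval x)).
  have [st|st] := boolP (s <= t)%O; first by rewrite (trE A st) mE.
  by rewrite !tr0 // !lfunE /= linear0.
have [||i iE] := @build_pmor_fun A M (fun s x => vsval x).
- by move=> s a x y; rewrite linearP.
- by move=> s t x st; rewrite trA vsprojK ?trU.
have eI s x : e s x \in U s by rewrite memv_img ?memvf.
have [||p pE] := @build_pmor_fun M A (fun s x => vsproj (U s) (e s x)).
- by move=> s a x y; rewrite !linearP.
- by move=> s t x st; rewrite trA vsprojK ?eI // pmor_tr.
exists A, i, p; split=> s x; first by rewrite pE iE eU vsvalK.
by rewrite pE iE vsprojK ?eI.
Qed.

Lemma pisoP M N : pisomorphic M N <->
  exists (f : pmor M N) (g : pmor N M), forall s,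
    cancel (f s) (g s) /\ cancel (g s) (f s).
Proof.
split=> -[f [g fg]]; exists f, g => s; have [fg1 fg2] := fg s.
  by split=> x; rewrite -comp_lfunE ?fg1 ?fg2 id_lfunE.
by split; apply/lfunP => x; rewrite comp_lfunE ?fg1 ?fg2 id_lfunE.
Qed.

Lemma psum_retracts A B : exists (iA : pmor A (psum A B)) (iB : pmor B (psum A B))
  (pA : pmor (psum A B) A) (pB : pmor (psum A B) B),
  forall s, [/\ forall x, iA s x = (x, 0), forall x, iB s x = (0, x),
    forall x, pA s x = x.1 & forall x, pB s x = x.2].
Proof.
have [||iA iAE] := @build_pmor_fun A (psum A B) (fun s x => (x, 0)).
- by move=> s a x y; congr pair; rewrite /= ?scaler0 ?addr0.
- by move=> s t x st; rewrite tr_psum linear0.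
have [||iB iBE] := @build_pmor_fun B (psum A B) (fun s x => (0, x)).
- by move=> s a x y; congr pair; rewrite /= ?scaler0 ?addr0.
- by move=> s t x st; rewrite tr_psum linear0.
have [||pA pAE] := @build_pmor_fun (psum A B) A (fun s x => x.1).
- by [].
- by move=> s t [x1 x2] st; rewrite tr_psum.
have [||pB pBE] := @build_pmor_fun (psum A B) B (fun s x => x.2).
- by [].
- by move=> s t [x1 x2] st; rewrite tr_psum.
by exists iA, iB, pA, pB.
Qed.

Lemma piso_psumP M A B : pisomorphic M (psum A B) <->
  exists (iA : pmor A M) (iB : pmor B M) (pA : pmor M A) (pB : pmor M B),
  forall s, [/\ forall x, pA s (iA s x) = x, forall x, pB s (iB s x) = x,
    forall x, pA s (iB s x) = 0, forall x, pB s (iA s x) = 0 &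
    forall x, iA s (pA s x) + iB s (pB s x) = x].
Proof.
have [jA [jB [qA [qB jq]]]] := psum_retracts A B.
split=> [/pisoP[f [g fg]]|[iA [iB [pA [pB ip]]]]].
  exists (pmor_comp g jA), (pmor_comp g jB), (pmor_comp qA f), (pmor_comp qB f).
  move=> s; have [jAE jBE qAE qBE] := jq s; have [gK fK] := fg s.
  split=> x; rewrite /= !comp_lfunE ?fK ?jAE ?jBE ?qAE ?qBE //.
  rewrite -linearD -[RHS]gK; congr (g s _).
  by case: (f s x) => a b; congr pair; rewrite /= ?addr0 ?add0r.
apply/pisoP.
have [||f fE] := @build_pmor_fun M (psum A B) (fun s x => (pA s x, pB s x)).
- by move=> s a x y; congr pair; rewrite linearP.
- by move=> s t x st; rewrite tr_psum !pmor_tr.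
have [||g gE] := @build_pmor_fun (psum A B) M (fun s x => iA s x.1 + iB s x.2).
- by move=> s a x y; rewrite !linearP scalerDr addrACA.
- by move=> s t [x y] st; rewrite tr_psum /= !pmor_tr linearD.
exists f, g => s; have [h1 h2 h3 h4 h5] := ip s; split=> [x|[x y]].
  by rewrite gE fE /= h5.
by rewrite gE fE /= !linearD /= h1 h2 h3 h4 addr0 add0r.
Qed.

Lemma idempotent_decomp M (e e' : pmor M M) A B
    (iA : pmor A M) (iB : pmor B M) (pA : pmor M A) (pB : pmor M B) :
  pidempotent e -> (forall s x, e' s x = x - e s x) ->
  (forall s x, pA s (iA s x) = x) -> (forall s x, iA s (pA s x) = e s x) ->
  (forall s x, pB s (iB s x) = x) -> (forall s x, iB s (pB s x) = e' s x) ->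
  pisomorphic M (psum A B).
Proof.
move=> ee e'E pi ip pi' ip'; apply/piso_psumP; exists iA, iB, pA, pB => s.
have eB x : e s (iB s x) = 0.
  have : iB s x = iB s x - e s (iB s x) by rewrite -e'E -ip' pi'.
  by move/eqP; rewrite eq_sym -subr_eq0 addrC addKr oppr_eq0 => /eqP.
split=> // x.
- by rewrite -[LHS]pi ip eB linear0.
- by rewrite -[LHS]pi' ip' e'E -ip pi subrr linear0.
- by rewrite ip ip' e'E addrC subrK.
Qed.

Definition is_zero M N (f : pmor M N) := forall s x, f s x = 0.

Lemma indecomposable_idempotent M (e : pmor M M) : pindecomposable M ->
  pidempotent e -> is_zero e \/ forall s x, e s x = x.
Proof.
move=> [_ Mind] ee; have [e' [ee' e'E]] := compl_idempotent ee.
have [A [iA [pA [pi ip]]]] := split_idempotent ee.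
have [B [iB [pB [pi' ip']]]] := split_idempotent ee'.
have MAB := idempotent_decomp ee e'E pi ip pi' ip'.
have [A0|A0] := pselect (pnonzero A); last first.
  left=> s x; rewrite -ip; have [->|px] := eqVneq (pA s x) 0; first exact: linear0.
  by case: A0; exists s, (pA s x).
right=> s x; apply/eqP; rewrite eq_sym -subr_eq0 -e'E -ip'.
have [->|px] := eqVneq (pB s x) 0; first by rewrite linear0.
by case: Mind; exists A, B; split=> //; exists s, (pB s x).
Qed.

Lemma idempotent_indecomposable M : pnonzero M ->
  (forall e : pmor M M, pidempotent e -> is_zero e \/ forall s x, e s x = x) ->
  pindecomposable M.
Proof.
move=> M0 Mi; split=> // -[A [B [[s [a a0]] [t [b b0]] /piso_psumP]]].
move=> [iA [iB [pA [pB ip]]]].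
have [s' x|e0|e1] := Mi (pmor_comp iA pA).
- by rewrite /= !comp_lfunE; have [-> ] := ip s'.
- have [h _ _ _ _] := ip s; move: (congr1 (pA s) (e0 s (iA s a))).
  by rewrite /= comp_lfunE !h linear0; apply/eqP.
- have [_ h h' _ _] := ip t; move: (congr1 (pB t) (e1 t (iB t b))).
  by rewrite /= comp_lfunE h h' !linear0 => /esym; apply/eqP.
Qed.

Lemma pindecomposable_iso M N :
  pisomorphic M N -> pindecomposable M -> pindecomposable N.
Proof.
move=> MN [[s [x x0]] Mind]; split; last first.
  move=> [A [B [A0 B0 NAB]]]; apply: Mind; exists A, B; split=> //.
  exact: pisomorphic_trans MN NAB.
have /pisoP[f [g fg]] := MN; exists s, (f s x); apply: contra_neq x0 => fx.
by have [fK _] := fg s; rewrite -[x]fK fx linear0.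
Qed.

(* The structure maps preserve kernels and images of powers of [f], so the
   projections of the Fitting decompositions of the [f s] form an endomorphism. *)
Lemma indecomposable_fitting M (f : pmor M M) : pindecomposable M ->
  (forall s x, f s x = 0 -> x = 0) \/
  (forall s x, exists m, iter m (f s) x = 0).
Proof.
move=> Mind; pose e s := projT1 (cid (fitting_lfun (f s))).
have eP s := projT2 (cid (fitting_lfun (f s))).
have iter_tr s t x m : iter m (f t) (tr M s t x) = tr M s t (iter m (f s) x).
  by elim: m => //= m ->; rewrite pmor_tr.
have [|g gE] := @build_pmor _ _ _ M M e.
  move=> s t x st; have [K [e1 e2 _ _]] := eP s; have [K' [_ _ e3 e4]] := eP t.
  rewrite /e; pose y := projT1 (cid (fitting_lfun (f s))) x; rewrite -/y.
  have -> : tr M s t x = tr M s t (x - y) + tr M s t y by rewrite -linearD subrK.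
  rewrite linearD /= (e3 _ K); last by rewrite iter_tr [X in tr _ _ _ X]e1 linear0.
  rewrite add0r.
  apply: e4 => j; rewrite /y; have [z ->] := e2 x j; exists (tr M s t z).
  by rewrite iter_tr.
have [s x|g0|g1] := indecomposable_idempotent (e := g) Mind.
- by rewrite gE /e; have [K [_ e2 _ e4]] := eP s; apply: e4.
- right=> s x; have [K [e1 _ _ _]] := eP s; exists K.
  by move: (e1 x); rewrite -/(e s) -gE g0 subr0.
left=> s x fx; have [K [_ _ e3 _]] := eP s.
by rewrite -[x]g1 gE /e; apply: (e3 _ 1%N).
Qed.

(** If [f] is not injective, it is locally nilpotent; as [f] acts as the identity on the kernel of
    [g], that kernel is zero. *)
Lemma indecomposable_local M (f g : pmor M M) : pindecomposable M ->
  (forall s x, f s x + g s x = x) ->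
  (forall s x, f s x = 0 -> x = 0) \/ (forall s x, g s x = 0 -> x = 0).
Proof.
move=> Mind fg; have [|fn] := indecomposable_fitting f Mind; first by left.
right=> s x gx; have fx : f s x = x by rewrite -[RHS]fg gx addr0.
have [m] := fn s x; suff -> : iter m (f s) x = x by [].
by elim: m => //= m ->.
Qed.

Lemma inverse_pmor M N (f : pmor M N) :
  (forall s, lker (f s) = 0%VS) -> (forall s, limg (f s) = fullv) ->
  exists g : pmor N M, forall s, cancel (f s) (g s) /\ cancel (g s) (f s).
Proof.
move=> f0 fI.
have fK s : cancel (f s) (f s)^-1%VF by apply: lker0_lfunK; rewrite f0.
have fV s : cancel (f s)^-1%VF (f s) by move=> y; rewrite limg_lfunVK // fI memvf.
have [|g gE] := @build_pmor _ _ _ N M (fun s => (f s)^-1%VF).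
  by move=> s t x st; rewrite -{1}[x]fV -pmor_tr fK.
by exists g => s; split=> x; rewrite gE ?fK ?fV.
Qed.

(** Injectivity suffices because the spaces [M s] are finite dimensional. *)
Lemma inverse_endo M (f : pmor M M) : (forall s x, f s x = 0 -> x = 0) ->
  exists g : pmor M M, forall s, cancel (f s) (g s) /\ cancel (g s) (f s).
Proof.
move=> f0; have K s : lker (f s) = 0%VS.
  apply/eqP; rewrite -subv0; apply/subvP => x; rewrite memv_ker memv0.
  by move=> /eqP/f0 ->.
apply: inverse_pmor => // s; apply/eqP; rewrite eqEdim subvf /=.
by rewrite limg_dim_eq // K capv0.
Qed.

End Idempotents.

(** * Shifts and interleavings *)

Lemma small_forall (R : realType) (T : finType) (P : T -> R -> Prop) :
  (forall i, exists2 r0, 0 < r0 & forall r, 0 <= r <= r0 -> P i r) ->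
  exists2 r0, 0 < r0 & forall r, 0 <= r <= r0 -> forall i, P i r.
Proof.
move=> H; have /choice[f fP] : forall i, exists r0, 0 < r0 /\ forall r, 0 <= r <= r0 -> P i r.
  by move=> i; have [r0 ? ?] := H i; exists r0.
exists (\big[Num.min/1]_i f i).
  by apply: lt_bigmin => // i _; have [] := fP i.
move=> r /andP[r0 rf] i; have [_ ] := fP i; apply; rewrite r0 /=.
by apply: le_trans rf _; apply: bigmin_le_cond.
Qed.

Lemma leRnP (R : realType) (n : nat) (s t : 'I_n -> R) :
  reflect (forall l, s l <= t l) (s <= t)%O.
Proof. exact: asboolP. Qed.

Ltac translate_lra := apply/leRnP => l; rewrite /translate; lra.

Section Interleavings.
Variables (R : realType) (k : fieldType) (n : nat).
Local Notation Rn := ('I_n -> R).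
Local Notation pmod := (pmod R k n).
Implicit Types (M N P A B : pmod) (s t u : Rn) (r : R).

Lemma le_translate r s t : (translate s r <= translate t r)%O = (s <= t)%O.
Proof.
apply/leRnP/leRnP => h l; have := h l; rewrite /translate; lra.
Qed.

Lemma translate_ge r s : 0 <= r -> (s <= translate s r)%O.
Proof. by move=> r0; apply/leRnP => l; rewrite /translate; lra. Qed.

Lemma tr_pshift M r s t x :
  tr (pshift M r) s t x = tr M (translate s r) (translate t r) x.
Proof.
have [st|st] := boolP (s <= t)%O; last by rewrite !tr0 ?le_translate.
by rewrite (trE _ st) (trE _ (translate_le r st)).
Qed.

Lemma pshift_tr M N r (f : pmor M (pshift N r)) s t x :
  f t (tr M s t x) = tr N (translate s r) (translate t r) (f s x).
Proof. by rewrite pmor_tr tr_pshift. Qed.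

Lemma pshift_pmor M N r (f : pmor M N) :
  exists g : pmor (pshift M r) (pshift N r), forall s x, g s x = f (translate s r) x.
Proof.
have [|g gE] := @build_pmor _ _ _ (pshift M r) (pshift N r)
  (fun s => f (translate s r)).
  by move=> s t x st; rewrite !tr_pshift /= pmor_tr.
by exists g => s x; rewrite gE.
Qed.

Lemma pshift_eta M r : 0 <= r -> exists g : pmor M (pshift M r),
  forall s x, g s x = tr M s (translate s r) x.
Proof.
move=> r0; have [|g gE] := @build_pmor _ _ _ M (pshift M r)
  (fun s => tr M s (translate s r)).
  move=> s t x st; rewrite tr_pshift !tr_tr ?translate_ge ?le_translate //.
by exists g => s x; rewrite gE.
Qed.

Lemma pshift_eta2 M r : 0 <= r -> exists g : pmor M (pshift (pshift M r) r),
  forall s x, g s x = tr M s (translate (translate s r) r) x.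
Proof.
move=> r0.
have [eta etaE] := pshift_eta M r0; have [eta' etaE'] := pshift_eta (pshift M r) r0.
exists (pmor_comp eta' eta) => s y.
by rewrite /= comp_lfunE etaE' etaE tr_pshift tr_tr ?le_translate ?translate_ge.
Qed.

Lemma interleavedP r M N : 0 <= r -> interleaved r M N <->
  exists (f : pmor M (pshift N r)) (g : pmor N (pshift M r)),
  (forall s x, g (translate s r) (f s x) = tr M s (translate (translate s r) r) x) /\
  (forall s x, f (translate s r) (g s x) = tr N s (translate (translate s r) r) x).
Proof.
move=> r0; have h s : (s <= translate (translate s r) r)%O.
  by apply: le_trans (translate_ge _ r0) _; exact: translate_ge.
split=> -[f [g fg]]; exists f, g.
  split=> s x; have [h1 h2] := fg s (h s).
    by rewrite (trE _ (h s)) -h1 comp_lfunE.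
  by rewrite (trE _ (h s)) -h2 comp_lfunE.
move=> s hs; split; apply/lfunP => x; rewrite comp_lfunE -trE.
  exact: fg.1.
exact: fg.2.
Qed.

Lemma interleaved_trans r r' M N P : 0 <= r -> 0 <= r' ->
  interleaved r M N -> interleaved r' N P -> interleaved (r + r') M P.
Proof.
move=> r0 r0' /(interleavedP _ _ r0)[f [g [gf fg]]].
move=> /(interleavedP _ _ r0')[f' [g' [gf' fg']]].
apply/interleavedP; first exact: addr_ge0.
(* The two grades are equal but not convertible; a structure map between them adjusts the type of
   the composites. *)
have h1 s : (translate (translate s r) r' <= translate s (r + r'))%O.
  by apply/leRnP => l; rewrite /translate; lra.
have h2 s : (translate (translate s r') r <= translate s (r + r'))%O.
  by apply/leRnP => l; rewrite /translate; lra.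
have [||u uE] := @build_pmor_fun R k n M (pshift P (r + r'))
  (fun s x => tr P (translate (translate s r) r') _ (f' (translate s r) (f s x))).
- by move=> s a x y; rewrite !linearP.
- move=> s t x st; rewrite pshift_tr pshift_tr tr_pshift.
  by rewrite !tr_tr ?le_translate ?h1.
have [||v vE] := @build_pmor_fun R k n P (pshift M (r + r'))
  (fun s x => tr M (translate (translate s r') r) _ (g (translate s r') (g' s x))).
- by move=> s a x y; rewrite !linearP.
- move=> s t x st; rewrite pshift_tr pshift_tr tr_pshift.
  by rewrite !tr_tr ?le_translate ?h2.
exists u, v; split=> s x; rewrite uE vE.
  by rewrite pshift_tr gf' tr_tr ?pshift_tr ?gf ?tr_tr //; translate_lra.
by rewrite pshift_tr fg tr_tr ?pshift_tr ?fg' ?tr_tr //; translate_lra.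
Qed.

Lemma interleaved_isor r M N P : 0 <= r ->
  interleaved r M N -> pisomorphic N P -> interleaved r M P.
Proof.
move=> r0 MN /pisoP[f [g fg]]; rewrite -[r]addr0.
apply: interleaved_trans MN _ => //; apply/interleavedP => //.
have h s : (s <= translate s 0)%O by exact: translate_ge.
have [||u uE] := @build_pmor_fun R k n N (pshift P 0) (fun s x => tr P s _ (f s x)).
- by move=> s a x y; rewrite !linearP.
- by move=> s t x st; rewrite pmor_tr tr_pshift !tr_tr ?le_translate.
have [||v vE] := @build_pmor_fun R k n P (pshift N 0) (fun s x => tr N s _ (g s x)).
- by move=> s a x y; rewrite !linearP.
- by move=> s t x st; rewrite pmor_tr tr_pshift !tr_tr ?le_translate.
exists u, v; split=> s x; rewrite uE vE ?pmor_tr; have [fK gK] := fg s.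
  by rewrite fK tr_tr.
by rewrite gK tr_tr.
Qed.

(* Grades [p g] and [q h] not below [s] stay not below [translate s r] for all
   small [r], so that the presentation restricted to grades below [s] does not
   change. *)
Lemma presents_stable M (G H : finType) (p : G -> Rn) (q : H -> Rn)
    (F : H -> G -> k) (x : forall g, M (p g)) s : presents q F x ->
  exists2 r0, 0 < r0 & forall r, 0 <= r <= r0 -> forall t,
    (s <= t)%O -> (t <= translate s r)%O ->
    (forall y, tr M s t y = 0 -> y = 0) /\ (forall y, exists z, y = tr M s t z).
Proof.
move=> pr.
have gap (T : finType) (f : T -> Rn) : exists2 r0, 0 < r0 &
    forall r, 0 <= r <= r0 -> forall i, (f i <= translate s r)%O -> (f i <= s)%O.
  apply: small_forall => i; have [fs|/leRnP/existsNP[l /negP]] := boolP (f i <= s)%O.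
    by exists 1.
  rewrite -ltNge => sf; exists ((f i l - s l) / 2); first by lra.
  by move=> r r0 /leRnP/(_ l); rewrite /translate; lra.
have [rG rG0 hG] := gap _ p; have [rH rH0 hH] := gap _ q.
exists (Num.min rG rH); first by rewrite lt_min rG0.
move=> r; rewrite le_min => /and3P[r0 rG1 rH1] t st tr_.
have pG g : (p g <= t)%O -> (p g <= s)%O.
  by move=> pt; apply: (hG r); rewrite ?r0 ?(le_trans pt).
have pH h : (q h <= t)%O -> (q h <= s)%O.
  by move=> qt; apply: (hH r); rewrite ?r0 ?(le_trans qt).
split=> y.
  have [c cs ->] := pres_gen_supp pr y; rewrite tr_ev //.
  move=> /(pres_rel pr)[d dt cE]; apply/(pres_rel pr); exists d => [h /dt/pH //|g ps].
  exact: cE (le_trans ps st).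
have [c ct ->] := pres_gen_supp pr y; exists (ev x s c); rewrite tr_ev // => g.
by move=> /ct/pG.
Qed.

End Interleavings.

(** * Openness *)

Section Openness.
Variables (R : realType) (k : fieldType) (n : nat).
Local Notation Rn := ('I_n -> R).
Local Notation pmod := (pmod R k n).
Implicit Types (M N A T : pmod) (s t u : Rn).

Section Lift.
Variables (M N : pmod) (G H : finType) (p : G -> Rn) (q : H -> Rn).
Variables (F : H -> G -> k) (x : forall g, M (p g)) (r : R).
Hypothesis pr : presents q F x.
Hypothesis r0 : 0 <= r.
Variables (f : pmor M (pshift N r)) (g : pmor N (pshift M r)).
Hypothesis gf : forall s y,
  g (translate s r) (f s y) = tr M s (translate (translate s r) r) y.
Let tt s := translate (translate s r) r.
Hypothesis injp : forall i y, tr M (p i) (tt (p i)) y = 0 -> y = 0.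
Hypothesis surp : forall i y, exists z, y = tr M (p i) (tt (p i)) z.
Hypothesis injq : forall j y, tr M (q j) (tt (q j)) y = 0 -> y = 0.

(** Conjugating [e] by the interleaving gives a map from [M] to its shift by [2r]; [a] is its
    factorisation through the structure maps. *)
Definition lifts (e : pmor N N) (a : pmor M M) := forall s y,
  g (translate s r) (e (translate s r) (f s y)) = tr M s (tt s) (a s y).

(** Images of the generators are pulled back by [surp]. They satisfy the relations because, by
    [injq], this may be tested after the shift, where it holds for the conjugate of [e]. *)
Lemma lift_exists e : exists a, lifts e a.
Proof.
have [g1 g1E] := pshift_pmor r g; have [e1 e1E] := pshift_pmor r e.
have [eta2 eta2E] := pshift_eta2 M r0.
pose phi := pmor_comp g1 (pmor_comp e1 f).
have phiE s y : phi s y = g (translate s r) (e (translate s r) (f s y)).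
  by rewrite /= !comp_lfunE g1E e1E.
pose y i := sval (cid (surp (phi (p i) (x i)))).
have yE i : eta2 (p i) (y i) = phi (p i) (x i).
  by rewrite /y eta2E; case: cid.
have [j|a aE] := pres_pmor pr (y := y).
  have phi0 : phi (q j) (ev x (q j) (F j)) = 0 by rewrite (pres_rel0 pr) linear0.
  apply: injq; rewrite -eta2E pmor_ev -[RHS]phi0 pmor_ev.
  by apply: eq_bigr => i _; rewrite yE.
exists a => s z; rewrite -phiE -eta2E -[eta2 s _]comp_lfunE.
rewrite -[(eta2 s \o a s)%VF]/(pmor_comp eta2 a s).
have -> // := pmor_gen_ext (u := phi) (v := pmor_comp eta2 a) pr.
by move=> i; rewrite [RHS]comp_lfunE aE yE.
Qed.

Lemma lift_uniq (d : pmor M M) :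
  (forall s y, tr M s (tt s) (d s y) = 0) -> is_zero d.
Proof.
move=> d0 s y; have [c ->] := pres_gen pr y; rewrite pmor_ev /ev big1 // => i _.
by rewrite (injp (d0 _ _)) linear0 scaler0.
Qed.

Lemma lift_sum e1 e2 e a1 a2 a : lifts e1 a1 -> lifts e2 a2 -> lifts e a ->
  (forall s y, e s y = e1 s y + e2 s y) -> forall s y, a s y = a1 s y + a2 s y.
Proof.
move=> l1 l2 l eE s y.
have [||d dE] := @build_pmor_fun R k n M M (fun s y => a s y - (a1 s y + a2 s y)).
- move=> u b y1 y2.
  by rewrite !linearP scalerBr scalerDr [X in _ - X]addrACA opprD addrACA.
- move=> u v z uv; rewrite !pmor_tr [RHS]linearB; congr (_ - _).
  by rewrite [RHS]linearD.
apply/eqP; rewrite -subr_eq0 -dE; apply/eqP; apply: lift_uniq => u z.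
by rewrite dE linearB linearD /= -l -l1 -l2 eE [g _ (_ + _)]linearD subrr.
Qed.

Lemma lift_id e a : lifts e a -> (forall s y, e s y = y) -> forall s y, a s y = y.
Proof.
move=> l eE s y.
have [||d dE] := @build_pmor_fun R k n M M (fun s y => a s y - y).
- by move=> u b y1 y2; rewrite linearP scalerBr opprD addrACA.
- by move=> u v z uv; rewrite pmor_tr linearB.
apply/eqP; rewrite -subr_eq0 -dE; apply/eqP; apply: lift_uniq => u z.
by rewrite dE linearB /= -l eE gf subrr.
Qed.

End Lift.

(* Among the idempotents [e] of [N] whose lift to [M] restricts to an
   automorphism of [A], one of minimal rank has indecomposable image. *)
Lemma eps_indecomposable_open M eps :
  finitely_presentable M -> eps_indecomposable eps M ->
  exists2 r0, 0 < r0 & forall r N, 0 <= r <= r0 ->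
    finitely_presentable N -> interleaved r M N -> eps_indecomposable eps N.
Proof.
move=> /fp_presents[G [H [p [q [F [x pr]]]]]].
move=> [A [T [Aind [e' /andP[e'0 e'eps] T0] /piso_psumP[i [j [pA [pT ip]]]]]]].
have [rp rp0 hp] := small_forall (fun g => presents_stable (p g) pr).
have [rq rq0 hq] := small_forall (fun h => presents_stable (q h) pr).
(* The shift [2r] has to stay in the stability range of all grades of [M]. The complement turns out
   to be killed by [e' + 4r]; dividing by 5 makes this strictly less than [eps]. *)
exists (Num.min (Num.min (rp / 2) (rq / 2)) ((eps - e') / 5)).
  by rewrite !lt_min; apply/andP; split; [apply/andP; split|]; lra.
move=> r N /andP[r0]; rewrite !le_min => /andP[/andP[rrp rrq] re] /fp_presents.
move=> [G' [H' [p' [q' [F' [x' pr']]]]]] /(interleavedP _ _ r0)[f [g [gf fg]]].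
pose tt s := translate (translate s r) r.
have tt_ge s : (s <= tt s)%O by rewrite /tt; translate_lra.
have tt_le s : (tt s <= translate s (r + r))%O by rewrite /tt; translate_lra.
have stp l : _ := hp (r + r) ltac:(lra) l _ (tt_ge (p l)) (tt_le (p l)).
have stq l : _ := hq (r + r) ltac:(lra) l _ (tt_ge (q l)) (tt_le (q l)).
have injp l := (stp l).1; have surp l := (stp l).2; have injq l := (stq l).1.
have lE := lift_exists pr r0 f g surp injq.
have lsum := lift_sum pr injp (f := f) (g := g).
pose on_A (a : pmor M M) := forall s y, pA s (a s (i s y)) = 0 -> y = 0.
pose good (e : pmor N N) := pidempotent e /\ exists2 a, lifts f g e a & on_A a.
(* Ranks at the generator grades of [N] form a finite sum, and an endomorphism is determined by its
   values there. *)
pose mu (e : pmor N N) := (\sum_l \dim (limg (e (p' l))))%N.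
have [e [ee [a la aA]] emin] : exists2 e, good e & forall e1, good e1 -> (mu e <= mu e1)%N.
  have ex : exists m, `[< exists2 e, good e & mu e = m >].
    exists (mu (pmor_id N)); apply/asboolP; exists (pmor_id N) => //; split.
      by move=> s y; rewrite !id_lfunE.
    have [a la] := lE (pmor_id N); exists a => // s y.
    rewrite (lift_id pr gf injp la) => [|u z]; last by rewrite id_lfunE.
    by have [-> _ _ _ _] := ip s.
  case: (ex_minnP ex) => m /asboolP[e ge <-] mmin; exists e => // e1 ge1.
  by apply: mmin; apply/asboolP; exists e1.
have [e2 [ee2 e2E]] := compl_idempotent ee.
have [B [iB [pB [pi ip']]]] := split_idempotent ee.
have [C [iC [pC [pi2 ip2]]]] := split_idempotent ee2.
exists B, C; split; last exact: idempotent_decomp ee e2E pi ip' pi2 ip2.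
- apply: idempotent_indecomposable.
    (* If the image of [e] were zero, the lift of [e] would be zero, yet it is injective on the
       non-zero module [A]. *)
    have [[s [y y0]] _] := Aind; apply: contrapT => nB.
    have e0 u z : e u z = 0.
      rewrite -ip'; have [->|pz] := eqVneq (pB u z) 0; first by rewrite linear0.
      by case: nB; exists u, (pB u z).
    have a0 : is_zero a.
      by apply: (lift_uniq (x := x) (r := r) pr injp) => u z; rewrite -la e0 linear0.
    by move: y0; rewrite (aA s y) ?eqxx // a0 linear0.
  (* By minimality, [e1] and [e] agree on the generators of [N]. *)
  have full (b : pmor B B) (e1 : pmor N N) (a1 : pmor M M) : pidempotent b ->
      (forall s y, e1 s y = iB s (b s (pB s y))) -> lifts f g e1 a1 -> on_A a1 ->
      forall s y, b s y = y.
    move=> bb e1E la1 a1A.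
    have e1e1 : pidempotent e1 by move=> s y; rewrite !e1E pi bb.
    have e1s s : (limg (e1 s) <= limg (e s))%VS.
      apply/subvP => _ /memv_imgP[y _ ->].
      have -> : e1 s y = e s (iB s (b s (pB s y))) by rewrite e1E -ip' pi.
      by rewrite memv_img ?memvf.
    have le1 l : (\dim (limg (e1 (p' l))) <= \dim (limg (e (p' l)))
        ?= iff (limg (e1 (p' l)) == limg (e (p' l))))%N.
      by apply: dimv_leqif_eq; exact: e1s.
    have elim1 l : limg (e1 (p' l)) = limg (e (p' l)).
      have [mle meq] := leqif_sum (fun l (_ : predT l) => le1 l).
      have : mu e1 == mu e by rewrite eqn_leq mle emin //; split=> //; exists a1.
      by rewrite meq => /forallP/(_ l)/eqP.
    have e1e u : e1 u = e u.
      apply: (pmor_gen_ext pr') => l.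
      have : e (p' l) (x' l) \in limg (e1 (p' l)).
        by rewrite elim1 memv_img ?memvf.
      move=> /memv_imgP[w _ ewE].
      have <- : e1 (p' l) (e (p' l) (x' l)) = e1 (p' l) (x' l) by rewrite !e1E -ip' pi.
      by rewrite ewE e1e1.
    by move=> s y; rewrite -[LHS]pi -[y in b s y]pi -e1E e1e -ip' !pi.
  move=> b bb; have [b2 [bb2 b2E]] := compl_idempotent bb.
  pose e1 := pmor_comp iB (pmor_comp b pB); pose e3 := pmor_comp iB (pmor_comp b2 pB).
  have e1E s y : e1 s y = iB s (b s (pB s y)) by rewrite /= !comp_lfunE.
  have e3E s y : e3 s y = iB s (b2 s (pB s y)) by rewrite /= !comp_lfunE.
  have [a1 la1] := lE e1; have [a3 la3] := lE e3.
  have aE := lsum _ _ _ _ _ _ la1 la3 la.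
  have {}aE s y : a s y = a1 s y + a3 s y.
    apply: aE => u z; rewrite e1E e3E -linearD b2E /=.
    by rewrite addrC subrK ip'.
  (* An idempotent [b] of [B] splits [e] as [e1 + e3]. Normalised by the inverse [v] of the corner
     of [a] on [A], the corners of [a1] and [a3] add up to the identity of [A]; locality makes one
     of them injective, and then [full] applies. *)
  have [s y /=|v vK] := @inverse_endo _ _ _ _ (pmor_comp pA (pmor_comp a i)).
    by rewrite !comp_lfunE; exact: aA.
  pose w (a0 : pmor M M) := pmor_comp v (pmor_comp pA (pmor_comp a0 i)).
  have wE a0 s y : w a0 s y = v s (pA s (a0 s (i s y))) by rewrite /= !comp_lfunE.
  have [s y|w1|w3] := indecomposable_local (f := w a1) (g := w a3) Aind.
  - rewrite !wE -linearD -linearD -aE; have [vf _] := vK s.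
    by rewrite -[RHS]vf /= !comp_lfunE.
  - right; apply: (full b e1 a1) => // s y ay; apply: (w1 s).
    by rewrite wE ay linear0.
  - left=> s y; have : b2 s y = y.
      apply: (full b2 e3 a3) => // u z az; apply: (w3 u).
      by rewrite wE az linear0.
    rewrite b2E => /eqP; rewrite -subr_eq0 addrC addKr oppr_eq0.
    by move/eqP.
(* An element of [C] goes to [M] by [g] (shift [r]), is annihilated by [a] after a further [2r],
   hence vanishes after [e'], and returns to [N] by [f] (shift [r]). *)
exists (e' + 4 * r); first by lra.
move=> s h; apply/lfunP => y; rewrite -trE lfunE /= -[LHS]pi2 pmor_tr.
set z := iC s y.
have ez : e s z = 0.
  have : e2 s z = z by rewrite -ip2 /z pi2.
  by rewrite e2E => /eqP; rewrite -subr_eq0 addrC addKr oppr_eq0 => /eqP.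
(* The shift by [e'] removes the component in [T]; what remains lies in [A], where the corner of [a]
   is injective. *)
have vanish t (w : M t) : a t w = 0 -> tr M t (translate t e') w = 0.
  move=> aw; set t' := translate t e'; set w' := tr _ _ _ _.
  have [_ _ _ _ w'E] := ip t'.
  have pTw : pT t' w' = 0.
    rewrite /w' pmor_tr; have ht : (t <= t')%O by exact: translate_ge.
    by rewrite (trE _ ht) T0 lfunE.
  have w'E' : i t' (pA t' w') = w' by rewrite -[RHS]w'E pTw linear0 addr0.
  have pAw : pA t' w' = 0.
    by apply: aA; rewrite w'E' /w' pmor_tr aw !linear0.
  by rewrite -w'E' pAw linear0.
set s1 := translate s r; set s3 := tt s1; set s4 := translate s3 r.
have a0 : a s3 (tr M s1 s3 (g s z)) = 0.
  rewrite pmor_tr -la fg.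
  by rewrite pmor_tr ez !linear0.
have := congr1 (f _) (vanish _ _ a0); rewrite linear0.
rewrite pshift_tr pshift_tr fg => /(congr1 (tr N _ (translate s (e' + 4 * r)))).
rewrite linear0 !tr_tr; first by move=> ->; rewrite linear0.
all: by rewrite /s4 /s3 /s1 /tt; translate_lra.
Qed.

End Openness.

(** * A criterion for indecomposability *)

Section Criterion.
Variables (R : realType) (k : fieldType) (n : nat).
Local Notation Rn := ('I_n -> R).
Local Notation pmod := (pmod R k n).
Implicit Types (s t u : Rn).
Variables (M : pmod) (G H : finType) (p : G -> Rn) (q : H -> Rn).
Variables (F : H -> G -> k) (x : forall g, M (p g)).
Hypothesis pr : presents q F x.

(* [e] lifts to an endomorphism [(C, d)] of the presentation. *)
Lemma endo_lift (e : pmor M M) : exists C : G -> G -> k, [/\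
  forall g g', C g g' != 0 -> (p g' <= p g)%O,
  forall g, e (p g) (x g) = ev x (p g) (C g) &
  forall h, exists2 d : H -> k, (forall h', d h' != 0 -> (q h' <= q h)%O) &
    forall g', (p g' <= q h)%O ->
      \sum_g F h g * C g g' = \sum_h' d h' * F h' g'].
Proof.
have /choice[C CP] : forall g, exists c : G -> k,
    (forall g', c g' != 0 -> (p g' <= p g)%O) /\ e (p g) (x g) = ev x (p g) c.
  by move=> g; have [c cs cE] := pres_gen_supp pr (e (p g) (x g)); exists c.
have Cs g g' : C g g' != 0 -> (p g' <= p g)%O by have [h _] := CP g; apply: h.
have CE g : e (p g) (x g) = ev x (p g) (C g) by have [] := CP g.
exists C; split=> // h.
apply/(pres_rel pr); rewrite ev_sum.
transitivity (e (q h) (ev x (q h) (F h))); last by rewrite (pres_rel0 pr) linear0.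
rewrite pmor_ev; apply: eq_bigr => g _.
have [->|Fhg] := eqVneq (F h g) 0; first by rewrite !scale0r.
by rewrite CE tr_ev //; [exact: Cs | exact: (pres_hom pr Fhg)].
Qed.

(* Comparing the coefficients of [x g] in the relation [h] and in its image
   under an endomorphism [C] leaves [F h g * C g g = d h * F h g]. *)
Definition pivot (h : H) (g : G) := [/\ F h g != 0,
  forall g', g' != g -> F h g' != 0 -> ~ (p g <= p g')%O &
  forall h', h' != h -> F h' g != 0 -> ~ (q h' <= q h)%O].

Lemma pivot_diag (e : pmor M M) : exists C : G -> G -> k, [/\
  forall g g', C g g' != 0 -> (p g' <= p g)%O,
  forall g, e (p g) (x g) = ev x (p g) (C g) &
  forall h g g', pivot h g -> pivot h g' -> C g g = C g' g'].
Proof.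
have [C [Cs CE Cd]] := endo_lift e; exists C; split=> // h g g'.
have [d ds dE] := Cd h.
have key l : pivot h l -> C l l = d h.
  move=> [Fl hG hH]; have := dE l (pres_hom pr Fl).
  rewrite (bigD1 l) //= big1 ?addr0 => [|l' l'l]; last first.
    apply/eqP; rewrite mulf_eq0 -implyNb; apply/implyP => /(hG _ l'l).
    by apply: contra_notT => /Cs.
  rewrite (bigD1 h) //= big1 ?addr0 => [|h' h'h].
    by rewrite mulrC => /(mulIf Fl).
  apply/eqP; rewrite mulf_eq0 orbC -implyNb; apply/implyP => /(hH _ h'h).
  by apply: contra_notT => /ds.
by move=> /key -> /key ->.
Qed.

Hypothesis p_inj : injective p.

(** Induction along the grades, which injectivity of [p] makes a strict order on generators. One has
    [e x = c x + y] with [y] a combination of earlier generators, already fixed by [e]; applying [e]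
    once more gives [c (e x) = c x]. *)
Lemma idempotent_diag (e : pmor M M) (C : G -> G -> k) c :
  pidempotent e -> (forall g g', C g g' != 0 -> (p g' <= p g)%O) ->
  (forall g, e (p g) (x g) = ev x (p g) (C g)) -> (forall g, C g g = c) ->
  c != 0 -> forall s y, e s y = y.
Proof.
move=> ee Cs CE Cc c0.
suff egen g : e (p g) (x g) = x g.
  move=> s y; rewrite (pmor_gen_ext pr (v := pmor_id M)) ?id_lfunE // => g.
  by rewrite egen id_lfunE.
pose down g := #|[pred g' | (p g' <= p g)%O]|.
have [m] := ubnP (down g); elim: m g => // m IHm g /ltnSE gm.
have IH g' : g' != g -> C g g' != 0 -> e (p g') (x g') = x g'.
  move=> g'g /Cs pg; apply: IHm; apply: leq_trans gm; apply: proper_card.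
  apply/properP; split.
    by apply/fintype.subsetP => l /(fun lg' : (p l <= p g')%O => le_trans lg' pg).
  exists g; first exact: lexx.
  apply: contra_neqN g'g => gg'; apply: p_inj; apply/eqP.
  by rewrite eq_le pg; exact: gg'.
have eE := CE g; rewrite /ev (bigD1 g) //= Cc tr_id in eE.
set y := \sum_(_ | _) _ in eE.
have ey : e (p g) y = y.
  rewrite linear_sum; apply: eq_bigr => g' g'g; rewrite linearZ /= pmor_tr.
  by have [->|Cg] := eqVneq (C g g') 0; rewrite ?scale0r // IH.
have := ee (p g) (x g); rewrite {1}eE linearD linearZ /= ey.
rewrite {2}eE => /addIr/eqP; rewrite -subr_eq0 -scalerBr scaler_eq0 (negbTE c0) /=.
by rewrite subr_eq0 => /eqP.
Qed.

(** The second hypothesis says that the graph joining generators with a common pivot relation is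
    connected, so an idempotent has constant diagonal. If the constant is non-zero, [e] is the
    identity; if it is 0, the same holds for the complement of [e], whose diagonal is 1. *)
Lemma pivot_indecomposable g0 : pnonzero M ->
  (forall c : G -> k, (forall h g g', pivot h g -> pivot h g' -> c g = c g') ->
    forall g, c g = c g0) ->
  pindecomposable M.
Proof.
move=> M0 conn; apply: idempotent_indecomposable => // e ee.
have [C [Cs CE Cp]] := pivot_diag e.
have Cc := conn (fun g => C g g) Cp.
have [c0|c0] := eqVneq (C g0 g0) 0; last by right; exact: idempotent_diag Cs CE Cc c0.
left=> s y; have [e2 [ee2 e2E]] := compl_idempotent ee.
pose C2 g g' := (g' == g)%:R - C g g'.
have : e2 s y = y.
  apply: (idempotent_diag (C := C2) (c := 1)) => //.
  - move=> g g'; rewrite /C2; case: (eqVneq g' g) => [-> //|_].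
    by rewrite sub0r oppr_eq0; exact: Cs.
  - move=> g; rewrite e2E CE evB; congr (_ - _).
    by rewrite ev_delta tr_id.
  - by move=> g; rewrite /C2 eqxx Cc c0 subr0.
  - exact: oner_neq0.
by rewrite e2E => /eqP; rewrite -subr_eq0 addrC addKr oppr_eq0 => /eqP.
Qed.

End Criterion.

(** * The indecomposable neighbour *)

Section GeneratorInterleaving.
Variables (R : realType) (k : fieldType) (n : nat).
Local Notation Rn := ('I_n -> R).
Local Notation pmod := (pmod R k n).

(** Both sides of a triangle identity are morphisms out of a presented module, so generators
    suffice. *)
Lemma interleaved_gens (r : R) (M N : pmod) (G H G' H' : finType)
    (p : G -> Rn) (q : H -> Rn) (F : H -> G -> k) (x : forall g, M (p g))
    (p' : G' -> Rn) (q' : H' -> Rn) (F' : H' -> G' -> k) (x' : forall g, N (p' g))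
    (f : pmor M (pshift N r)) (g : pmor N (pshift M r)) :
  0 <= r -> presents q F x -> presents q' F' x' ->
  (forall i, g (translate (p i) r) (f (p i) (x i)) =
     tr M (p i) (translate (translate (p i) r) r) (x i)) ->
  (forall i, f (translate (p' i) r) (g (p' i) (x' i)) =
     tr N (p' i) (translate (translate (p' i) r) r) (x' i)) ->
  interleaved r M N.
Proof.
move=> r0 pr pr' gf fg; apply/(interleavedP _ _ r0); exists f, g.
have aux (A B : pmod) (G1 H1 : finType) (p1 : G1 -> Rn) (q1 : H1 -> Rn)
    (F1 : H1 -> G1 -> k) (x1 : forall g, A (p1 g))
    (a : pmor A (pshift B r)) (b : pmor B (pshift A r)) : presents q1 F1 x1 ->
    (forall i, b (translate (p1 i) r) (a (p1 i) (x1 i)) =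
     tr A (p1 i) (translate (translate (p1 i) r) r) (x1 i)) ->
    forall s y, b (translate s r) (a s y) = tr A s (translate (translate s r) r) y.
  move=> pr1 ba s y; have [eta etaE] := pshift_eta2 A r0; have [b1 b1E] := pshift_pmor r b.
  rewrite -etaE -(pmor_gen_ext (u := pmor_comp b1 a) (v := eta) pr1) => [|i].
    by rewrite /= comp_lfunE b1E.
  by rewrite etaE /= comp_lfunE b1E ba.
by split; [exact: aux pr gf | exact: aux pr' fg].
Qed.

End GeneratorInterleaving.

(** Each value is raised by [2t] times its index. Equal values become at least [2t] apart; distinct
    ones start more than [(2m + 1) t] apart and lose at most [2m t]. The room of [5t] leaves space
    for a slab above each value. *)
Lemma separated_offsets (R : realType) (G : finType) (u : G -> R) (delta : R) :
  0 < delta -> exists (t : R) (al : G -> R), 0 < t /\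
    (forall i, u i <= al i /\ al i + 5 * t <= u i + delta) /\
    (forall i j, i != j -> t < `|al i - al j|).
Proof.
move=> delta0; pose m : R := #|G|%:R; have m0 : 0 <= m by exact: ler0n.
pose rk (i : G) : R := (enum_rank i)%:R.
have rk0 i : 0 <= rk i <= m by rewrite ler0n ler_nat ltnW.
have rk_sep i j : i != j -> 1 <= `|rk i - rk j|.
  move=> ij; rewrite /rk; have : (enum_rank i : nat) != enum_rank j.
    by apply: contra_neq ij => /val_inj/enum_rank_inj.
  case: ltngtP => // [lt|lt] _.
    by rewrite distrC ger0_norm ?subr_ge0 ?ler_nat 1?ltnW // lerBrDl natr1 ler_nat.
  by rewrite ger0_norm ?subr_ge0 ?ler_nat 1?ltnW // lerBrDl natr1 ler_nat.
have sep (ij : G * G) : exists2 r0, 0 < r0 & forall r, 0 <= r <= r0 ->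
    u ij.1 != u ij.2 -> (2 * m + 1) * r < `|u ij.1 - u ij.2|.
  have [->|uij] := eqVneq (u ij.1) (u ij.2); first by exists 1 => // r _ /eqP.
  have d0 : 0 < `|u ij.1 - u ij.2| by rewrite normr_gt0 subr_eq0.
  (* [2m + 2] instead of [2m + 1] makes the bound strict for positive [r]. *)
  exists (`|u ij.1 - u ij.2| / (2 * m + 2)); first by apply: divr_gt0 => //; lra.
  move=> r /andP[r0 rle] _.
  have : r * (2 * m + 2) <= `|u ij.1 - u ij.2| by rewrite -ler_pdivlMr //; lra.
  have [->|rn0] := eqVneq r 0; first by rewrite !mulr0.
  have : 0 < r by rewrite lt_def rn0.
  by nra.
have [r0 r00 rP] := small_forall sep.
pose t := Num.min r0 (delta / (2 * m + 5)).
have t0 : 0 < t by rewrite lt_min r00 divr_gt0 //; lra.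
have tr0 : t <= r0 by rewrite ge_min lexx.
have td : t * (2 * m + 5) <= delta.
  by rewrite -ler_pdivlMr ?ge_min ?lexx ?orbT //; lra.
exists t, (fun i => u i + 2 * t * rk i); split=> //; split=> [i|i j ij].
  by have /andP[? ?] := rk0 i; split; nra.
have sij := rk_sep _ _ ij; have /andP[? ?] := rk0 i; have /andP[? ?] := rk0 j.
have [uij|uij] := eqVneq (u i) (u j).
  rewrite uij.
  have -> : u j + 2 * t * rk i - (u j + 2 * t * rk j) = 2 * t * (rk i - rk j) by ring.
  by rewrite normrM gtr0_norm; [nra | lra].
have := rP t _ (i, j) uij; rewrite ltW //= tr0 => /(_ isT) h.
have -> : u i + 2 * t * rk i - (u j + 2 * t * rk j) =
  (u i - u j) + 2 * t * (rk i - rk j) by ring.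
have e1 : `|2 * t * (rk i - rk j)| <= 2 * m * t by rewrite ler_norml; apply/andP; split; nra.
have := lerB_normD (u i - u j) (2 * t * (rk i - rk j)).
by move: h e1 => /=; lra.
Qed.

(* The indecomposable neighbour of [M].  Every generator [x i] is split in two
   generators [X1 i], [X2 i] of incomparable grades.  Instead of identifying
   them, the relation [Z i] makes their difference equal to [V i], which spans a
   thin slab [{al i + 2t <= s i0 < al i + 4t}]; by [Y i], all the [V i] agree with
   [W], which spans the slab [{delta - L <= s i1 < 2 delta - L}], on the intersections
   of the slabs far below the grades of [M].  [D i] and [E] bound the slabs.  As
   [bt i] decreases with [al i], the grades of the [Y i] are incomparable, and
   [W] still does not vanish at [Y i]. *)
Section Tack.
Variables (R : realType) (k : fieldType) (n : nat).
Local Notation Rn := ('I_n -> R).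
Local Notation pmod := (pmod R k n).
Variables (M : pmod) (G H : finType) (p : G -> Rn) (q : H -> Rn).
Variables (F : H -> G -> k) (x : forall g, M (p g)).
Hypothesis pr : presents q F x.
Variables (i0 i1 : 'I_n) (delta t B L : R) (al bt : G -> R).
Hypotheses (i01 : i1 != i0) (delta0 : 0 < delta) (t0 : 0 < t).
Hypotheses (al_ge : forall i, p i i0 <= al i).
Hypotheses (al_le : forall i, al i + 5 * t <= p i i0 + delta).
Hypotheses (al_sep : forall i j, i != j -> t < `|al i - al j|).
Hypotheses (pB : forall i l, - B <= p i l <= B) (BL : B + 3 * delta <= L).
Hypotheses (bt_range : forall i, delta - L <= bt i < 2 * delta - L).
Hypotheses (bt_anti : forall i j, al i < al j -> bt j < bt i).

Definition tgen : finType := ((G + G) + (G + unit))%type.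
Definition trel : finType := ((H + G) + (G + (G + unit)))%type.
Notation X1 i := (inl (inl i) : tgen).
Notation X2 i := (inl (inr i) : tgen).
Notation V i := (inr (inl i) : tgen).
Notation W := (inr (inr tt) : tgen).
Notation Q j := (inl (inl j) : trel).
Notation Z i := (inl (inr i) : trel).
Notation Y i := (inr (inl i) : trel).
Notation D i := (inr (inr (inl i)) : trel).
Notation E := (inr (inr (inr tt)) : trel).

Definition pt (s : Rn) (a b : R) : Rn :=
  fun l => if l == i0 then a else if l == i1 then b else s l.

Definition low : Rn := fun=> - L.

Definition tp (g : tgen) : Rn := match g with
  | inl (inl i) => pt (p i) (al i + t) (p i i1)
  | inl (inr i) => pt (p i) (al i) (p i i1 + t)
  | inr (inl i) => pt low (al i + 2 * t) (- L)
  | inr (inr _) => pt low (- L) (delta - L)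
  end.

Definition tq (h : trel) : Rn := match h with
  | inl (inl j) => translate (q j) delta
  | inl (inr i) => pt (p i) (al i + 2 * t) (p i i1 + t)
  | inr (inl i) => pt low (al i + 3 * t) (bt i)
  | inr (inr (inl i)) => pt low (al i + 4 * t) (- L)
  | inr (inr (inr _)) => pt low (- L) (2 * delta - L)
  end.

Definition tF (h : trel) (g : tgen) : k := match h, g with
  | inl (inl j), inl (inl i) => F j i
  | inl (inr i), inl (inl i') => (i' == i)%:R
  | inl (inr i), inl (inr i') => - (i' == i)%:R
  | inl (inr i), inr (inl i') => - (i' == i)%:R
  | inr (inl i), inr (inl i') => (i' == i)%:R
  | inr (inl i), inr (inr _) => - 1
  | inr (inr (inl i)), inr (inl i') => (i' == i)%:R
  | inr (inr (inr _)), inr (inr _) => 1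
  | _, _ => 0
  end.

Lemma pt_i0 s a b : pt s a b i0 = a. Proof. by rewrite /pt eqxx. Qed.

Lemma pt_i1 s a b : pt s a b i1 = b.
Proof. by rewrite /pt (negbTE i01) eqxx. Qed.

Lemma pt_le s a b s' a' b' : a <= a' -> b <= b' ->
  (forall l, s l <= s' l) -> (pt s a b <= pt s' a' b')%O.
Proof. by move=> aa bb ss; apply/leRnP => l; rewrite /pt; do 2 case: ifP => _ //. Qed.

Lemma le_pt s a b s' a' b' : (pt s a b <= pt s' a' b')%O -> a <= a' /\ b <= b'.
Proof. by move=> /leRnP h; have := h i0; have := h i1; rewrite !pt_i0 !pt_i1. Qed.

Lemma p_bounds i l : [/\ - L < p i l, - L < al i & bt i < p i i1].
Proof.
have /andP[] := pB i l; have /andP[] := pB i i0; have /andP[] := pB i i1.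
have /andP[] := bt_range i; have := al_ge i; have := al_le i.
by move: delta0 t0 BL => *; split; lra.
Qed.

Ltac tack_lra i := have [] := p_bounds i i1; have := al_ge i; have := al_le i;
  have /andP[] := bt_range i; move: delta0 t0; lra.

Lemma nat_neq0 (i j : G) : (i == j)%:R != 0 :> k -> i = j.
Proof. by case: (eqVneq i j) => // _; rewrite eqxx. Qed.

Lemma tF_hom h g : tF h g != 0 -> (tp g <= tq h)%O.
Proof.
have lowp i l : low l <= p i l by have [/ltW] := p_bounds i l.
move: h g => [[j|i]|[i|[i|[]]]] [[i'|i']|[i'|[]]] //=; rewrite ?eqxx // ?oppr_eq0.
- move=> /(pres_hom pr)/leRnP pq; apply/leRnP => l; have := pq l.
  rewrite /translate /pt; have := al_ge i'; have := al_le i'; move: delta0 t0.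
  by case: ifP => [/eqP ->|_]; [|case: ifP => [/eqP ->|_]]; lra.
- by move=> /nat_neq0 ->; apply: pt_le => //; tack_lra i.
- by move=> /nat_neq0 ->; apply: pt_le => //; tack_lra i.
- by move=> /nat_neq0 ->; apply: pt_le => //; tack_lra i.
- by move=> /nat_neq0 ->; apply: pt_le => //; tack_lra i.
- by move=> _; apply: pt_le => //; tack_lra i.
- by move=> /nat_neq0 ->; apply: pt_le => //; tack_lra i.
- by move=> _; apply: pt_le => //; move: delta0; lra.
Qed.

Lemma al_inj i j : al i = al j -> i = j.
Proof.
move=> a; apply/eqP; apply: contraT => /al_sep.
by rewrite a subrr normr0; move: t0; lra.
Qed.

Lemma tp_inj : injective tp.
Proof.
(* An [X1 i] and an [X2 j] could share the coordinate [i0] only if two values of [al] differed by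
   exactly [t]. *)
have sep i j : al i + t = al j -> False.
  move=> a; have [ij|/al_sep] := eqVneq i j; first by rewrite ij in a; move: a t0; lra.
  by rewrite -a opprD addNKr normrN gtr0_norm // ltxx.
move=> g g' gg'; have := congr1 (@^~ i0) gg'; have := congr1 (@^~ i1) gg'.
move: g g' {gg'} => [[i|i]|[i|[]]] [[i'|i']|[i'|[]]] /=; rewrite !pt_i0 !pt_i1 //.
- by move=> _ /addIr/al_inj ->.
- by move=> _ /sep.
- move=> ? ?; exfalso; tack_lra i.
- move=> ? ?; exfalso; tack_lra i.
- by move=> _ /esym/sep.
- by move=> _ /al_inj ->.
- move=> ? ?; exfalso; tack_lra i.
- move=> ? ?; exfalso; tack_lra i.
- move=> ? ?; exfalso; tack_lra i'.
- move=> ? ?; exfalso; tack_lra i'.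
- by move=> _ /addIr/al_inj ->.
- move=> ? ?; exfalso; tack_lra i.
- move=> ? ?; exfalso; tack_lra i'.
- move=> ? ?; exfalso; tack_lra i'.
- move=> ? ?; exfalso; tack_lra i'.
Qed.

(** Along [X2 i], [X1 i], [V i] the coordinate [i0] increases and [i1] decreases, so the generators
    in [Z i] form an antichain; likewise [V i] and [W] in [Y i]. *)
Lemma tack_pivots : [/\ forall i, pivot tp tq tF (Z i) (X1 i),
  forall i, pivot tp tq tF (Z i) (X2 i), forall i, pivot tp tq tF (Z i) (V i),
  forall i, pivot tp tq tF (Y i) (V i) & forall i, pivot tp tq tF (Y i) W].
Proof.
split=> i; split=> /=; rewrite ?eqxx ?oppr_eq0 ?oner_neq0 //.
- move=> [[i'|i']|[i'|[]]] /=; rewrite ?eqxx ?oppr_eq0 // => + /nat_neq0 ii'.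
  + by rewrite ii' eqxx.
  + by move=> _ /le_pt[]; rewrite ii'; tack_lra i.
  + by move=> _ /le_pt[]; rewrite ii'; tack_lra i.
- move=> [[j|i']|[i'|[i'|[]]]] /=; rewrite ?eqxx //.
  (* The shift of the old relations by [delta] puts [Q j] beyond [Z i]: its coordinate [i0] is at
     least [al i + 5t], against [al i + 2t]. *)
  + move=> _ /(pres_hom pr)/leRnP/(_ i0) pq /leRnP/(_ i0).
    by rewrite pt_i0 /translate; move: pq; tack_lra i.
  + by move=> + /nat_neq0 ii'; rewrite ii' eqxx.
- move=> [[i'|i']|[i'|[]]] /=; rewrite ?eqxx ?oppr_eq0 // => + /nat_neq0 ii'.
  + by move=> _ /le_pt[]; rewrite ii'; tack_lra i.
  + by rewrite ii' eqxx.
  + by move=> _ /le_pt[]; rewrite ii'; tack_lra i.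
- move=> [[j|i']|[i'|[i'|[]]]] /=; rewrite ?eqxx ?oppr_eq0 //.
  by move=> + /nat_neq0 ii'; rewrite ii' eqxx.
- move=> [[i'|i']|[i'|[]]] /=; rewrite ?eqxx ?oppr_eq0 // => + /nat_neq0 ii'.
  + by move=> _ /le_pt[]; rewrite ii'; tack_lra i.
  + by move=> _ /le_pt[]; rewrite ii'; tack_lra i.
  + by rewrite ii' eqxx.
- move=> [[j|i']|[i'|[i'|[]]]] /=; rewrite ?eqxx ?oppr_eq0 // => + /nat_neq0 ii'.
  + by rewrite ii' eqxx.
  + by move=> _ /le_pt[]; rewrite ii'; tack_lra i'.
  + by move=> _ /le_pt[]; rewrite ii'; tack_lra i'.
- move=> [[i'|i']|[i'|[]]] /=; rewrite ?eqxx // => + +.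
  + by move=> + /nat_neq0 ii'; rewrite ii' eqxx.
  + by move=> _ _ /le_pt[]; tack_lra i.
- move=> [[j|i']|[i'|[i'|[]]]] /=; rewrite ?eqxx ?oppr_eq0 // => + /nat_neq0 ii'.
  + by move=> _ /le_pt[]; rewrite ii'; tack_lra i'.
  + by rewrite ii' eqxx.
  + by move=> _ /le_pt[]; rewrite ii'; tack_lra i'.
- move=> [[i'|i']|[i'|[]]] /=; rewrite ?eqxx //.
  by move=> _ _ /le_pt[]; tack_lra i.
- move=> [[j|i']|[i'|[i'|[]]]] /=; rewrite ?eqxx //.
  (* The antichain of the [Y i]: a smaller [al] comes with a larger [bt]. *)
  + move=> ii' _ /le_pt[ale ble].
    have [ii|ii] := eqVneq i' i; first by rewrite ii eqxx in ii'.
    have : al i' < al i.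
      rewrite lt_neqAle; apply/andP; split; last by move: ale; lra.
      by apply: contra_neq ii; exact: al_inj.
    by move/bt_anti; move: ble; lra.
  + by move=> _ _ /le_pt[_]; tack_lra i.
Qed.

Lemma tack_indecomposable (N : pmod) (y : forall g, N (tp g)) :
  presents tq tF y -> pindecomposable N.
Proof.
move=> prN; have [z1 z2 zv yv yw] := tack_pivots.
apply: (pivot_indecomposable prN tp_inj (g0 := W)).
  (* [W] is non-zero at its own grade, since no relation involving it, [Y i] or [E], has a grade
     below [tp W]. *)
  exists (tp W), (y W); apply/negP => /eqP y0.
  have : ev y (tp W) (fun g => (g == W)%:R) = 0 by rewrite ev_delta tr_id.
  move=> /(pres_rel prN)[d ds /(_ W (lexx _))/eqP]; rewrite eqxx big1 ?oner_eq0 //.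
  move=> h _; apply/eqP; rewrite mulf_eq0 -implyNb; apply/implyP => /ds.
  move: h => [[j|i]|[i|[i|[]]]] /=; rewrite ?eqxx //.
    by move=> /le_pt[]; tack_lra i.
  by move=> /le_pt[_]; move: delta0; lra.
move=> c cE; have cV i : c (V i) = c W by exact: cE (yv i) (yw i).
move=> [[i|i]|[i|[]]] //.
  by rewrite -(cV i); exact: cE (z1 i) (zv i).
by rewrite -(cV i); exact: cE (z2 i) (zv i).
Qed.

(** [x i] goes to [X1 i]; back, both copies go to [x i], and [V i], [W] go to 0. The round trip on
    [X2 i] yields [X1 i], which agrees with it by [Z i] once [V i] has died; [V i] and [W]
    themselves die within [2 delta]. *)
Lemma tack_interleaved (N : pmod) (y : forall g, N (tp g)) :
  presents tq tF y -> interleaved delta M N.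
Proof.
move=> prN; have dl0 : 0 <= delta by exact: ltW.
have leX1 i : (tp (X1 i) <= translate (p i) delta)%O.
  apply/leRnP => l; rewrite /= /pt /translate.
  by case: ifP => [/eqP ->|_]; [|case: ifP => [/eqP ->|_]]; tack_lra i.
have leX1' i : (p i <= translate (tp (X1 i)) delta)%O.
  apply/leRnP => l; rewrite /= /pt /translate.
  by case: ifP => [/eqP ->|_]; [|case: ifP => [/eqP ->|_]]; tack_lra i.
have leX2' i : (p i <= translate (tp (X2 i)) delta)%O.
  apply/leRnP => l; rewrite /= /pt /translate.
  by case: ifP => [/eqP ->|_]; [|case: ifP => [/eqP ->|_]]; tack_lra i.
have sum_delta (A : pmod) s (v : G -> A s) i : \sum_i' (i' == i)%:R *: v i' = v i.
  rewrite (bigD1 i) //= eqxx scale1r big1 ?addr0 // => i' /negbTE ->.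
  exact: scale0r.
have sum_deltaN (A : pmod) s (v : G -> A s) i : \sum_i' - (i' == i)%:R *: v i' = - v i.
  by under eq_bigr do rewrite scaleNr; rewrite sumrN sum_delta.
have sum0 (A : pmod) s (T : finType) (v : T -> A s) : \sum_i (0 : k) *: v i = 0.
  by rewrite big1 // => i' _; rewrite scale0r.
have sumz (A : pmod) s (T : finType) (c : T -> k) : \sum_i c i *: (0 : A s) = 0.
  by rewrite big1 // => i' _; rewrite scaler0.
have [j|f fE] := pres_pmor pr (N := pshift N delta)
    (y := fun i => tr N (tp (X1 i)) (translate (p i) delta) (y (X1 i))).
  transitivity (ev y (tq (Q j)) (tF (Q j))); last exact: pres_rel0 prN (Q j).
  rewrite /ev !big_sumType /=!sum0 !addr0.
  apply: eq_bigr => i _; rewrite tr_pshift.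
  have [->|/(pres_hom pr) pq] := eqVneq (F j i) 0; first by rewrite !scale0r.
  by rewrite tr_tr ?le_translate ?leX1.
pose z g : M (translate (tp g) delta) := match g with
  | inl (inl i) => tr M (p i) (translate (tp (X1 i)) delta) (x i)
  | inl (inr i) => tr M (p i) (translate (tp (X2 i)) delta) (x i)
  | inr _ => 0 end.
have [h|g gE] := pres_pmor prN (N := pshift M delta) (y := z).
  move: h => [[j|i]|[i|[i|[]]]]; rewrite /ev !big_sumType /= ?sum0 ?sum_delta ?sum_deltaN;
    rewrite ?linear0 ?scaler0 ?subr0 ?oppr0 ?addr0 ?big1_eq ?addr0 //.
    transitivity (tr M (q j) (translate (translate (q j) delta) delta) (ev x (q j) (F j))).
      rewrite tr_ev; last by translate_lra.
        apply: eq_bigr => i _; rewrite tr_pshift.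
        have [->|Fji] := eqVneq (F j i) 0; first by rewrite !scale0r.
        by rewrite tr_tr // le_translate; apply: tF_hom (Q j) (X1 i) Fji.
      exact: (pres_hom pr).
    by rewrite (pres_rel0 pr) linear0.
  rewrite !tr_pshift !tr_tr ?subrr // le_translate.
    by apply: (tF_hom (h := Z i) (g := X2 i)); rewrite /= eqxx oppr_eq0 oner_eq0.
  by apply: (tF_hom (h := Z i) (g := X1 i)); rewrite /= eqxx oner_eq0.
have yD i s : (tq (D i) <= s)%O -> tr N (tp (V i)) s (y (V i)) = 0.
  move=> Ds; have := pres_rel0 prN (D i).
  rewrite /ev !big_sumType /= ?sum0 ?sum_delta !add0r ?addr0 ?big1_eq ?addr0.
  move=> /(congr1 (tr N _ s)); rewrite linear0 tr_tr //.
  by apply: (tF_hom (h := D i) (g := V i)); rewrite /= eqxx oner_eq0.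
apply: (interleaved_gens (f := f) (g := g) dl0 pr prN) => [i|g0].
  rewrite fE pshift_tr gE /= tr_tr ?leX1' ?le_translate //.
  exact: leX1.
rewrite gE; move: g0 => [[i|i]|[i|[]]] /=.
- rewrite pshift_tr fE tr_tr ?leX1 ?le_translate //.
- rewrite pshift_tr fE tr_tr ?leX1 ?le_translate ?leX2' //.
  have := pres_rel0 prN (Z i).
  rewrite /ev !big_sumType /= ?sum0 ?sum_delta ?sum_deltaN ?scale0r ?addr0.
  move=> /(congr1 (tr N _ (translate (translate (tp (X2 i)) delta) delta))).
  have ZX1 := tF_hom (h := Z i) (g := X1 i); have ZX2 := tF_hom (h := Z i) (g := X2 i).
  have ZV := tF_hom (h := Z i) (g := V i).
  rewrite /= eqxx ?oppr_eq0 oner_eq0 in ZX1 ZX2 ZV.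
  have ZT : (tq (Z i) <= translate (translate (tp (X2 i)) delta) delta)%O.
    apply/leRnP => l; rewrite /= /pt /translate.
    by case: ifP => [_|_]; [|case: ifP => [_|_]]; tack_lra i.
  have DT : (tq (D i) <= translate (translate (tp (X2 i)) delta) delta)%O.
    apply/leRnP => l; rewrite /= /pt /translate /low; have [] := p_bounds i l.
    by case: ifP => [_|_]; [|case: ifP => [_|_]]; tack_lra i.
  rewrite linear0 2!linearB /= !tr_tr ?ZX1 ?ZX2 ?ZV // (yD _ _ DT) subr0.
  by move=> /eqP; rewrite subr_eq0 => /eqP.
- rewrite linear0 yD //; apply/leRnP => l; rewrite /= /pt /translate /low.
  by case: ifP => [_|_]; [|case: ifP => [_|_]]; tack_lra i.
- have := pres_rel0 prN E; rewrite /ev !big_sumType /= ?sum0 ?add0r.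
  rewrite (bigD1 tt) //= big1 ?addr0 ?scale1r; last by case.
  move=> /(congr1 (tr N _ (translate (translate (tp W) delta) delta))).
  rewrite !linear0 tr_tr //.
  + by apply: (tF_hom (h := E) (g := W)); rewrite /= oner_eq0.
  + apply/leRnP => l; rewrite /= /pt /translate /low; move: delta0.
    by case: ifP => [_|_]; [|case: ifP => [_|_]]; lra.
Qed.

End Tack.

(** * Density *)

Section Density.
Variables (R : realType) (k : fieldType) (n : nat).
Local Notation Rn := ('I_n -> R).
Local Notation pmod := (pmod R k n).
Implicit Types (M N : pmod).

Lemma indecomposable_nearby M delta : (2 <= n)%N -> 0 < delta ->
  finitely_presentable M -> exists N, [/\ finitely_presentable N,
    pindecomposable N & interleaved delta M N].
Proof.
move=> n2 delta0 /fp_presents[G [H [p [q [F [x pr]]]]]].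
pose i0 : 'I_n := Ordinal (ltnW n2); pose i1 : 'I_n := Ordinal n2.
have i01 : i1 != i0 by [].
have [t [al [t0 [al_bounds al_sep]]]] := separated_offsets (fun i => p i i0) delta0.
have al_ge i : p i i0 <= al i by have [] := al_bounds i.
have al_le i : al i + 5 * t <= p i i0 + delta by have [] := al_bounds i.
pose B : R := \big[Num.max/0]_(il : G * 'I_n) `|p il.1 il.2|.
have B0 : 0 <= B by exact: bigmax_ge_id.
have pB i l : - B <= p i l <= B.
  rewrite -ler_norml; exact: (le_bigmax _ (fun il : G * 'I_n => `|p il.1 il.2|) (i, l)).
(* [L - al i] lies in [[0, 2L)]; the slope [w] rescales this to [[0, delta)], so that [bt] is
   decreasing in [al] and stays in the slab of [W]. *)
pose L := B + 3 * delta; pose w := delta / (2 * L).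
have L0 : 0 < L by rewrite /L; lra.
have w0 : 0 < w by apply: divr_gt0 => //; lra.
have wL : w * (2 * L) = delta by rewrite /w mulfVK //; lra.
pose bt i := delta - L + w * (L - al i).
have bt_range i : delta - L <= bt i < 2 * delta - L.
  have := al_ge i; have := al_le i; have /andP[] := pB i i0 => *.
  have h1 : 0 <= L - al i by rewrite /L; lra.
  have h2 : L - al i < 2 * L by rewrite /L; lra.
  have := mulr_ge0 (ltW w0) h1; have : w * (L - al i) < delta by rewrite -[ltRHS]wL ltr_pM2l.
  by rewrite /bt; lra.
have bt_anti i j : al i < al j -> bt j < bt i.
  by move=> ij; rewrite /bt ltrD2l ltr_pM2l //; lra.
have BL : B + 3 * delta <= L by [].
have [N [fpN [y prN]]] := presents_fp
  (tF_hom pr i1 delta0 t0 al_ge al_le pB BL bt_range).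
exists N; split=> //.
  exact: (tack_indecomposable pr i01 delta0 t0 al_ge al_le al_sep pB BL bt_range bt_anti prN).
exact: (tack_interleaved pr delta0 t0 al_ge al_le pB BL bt_range prN).
Qed.

End Density.

(** * The topology generated by the balls *)

Section Topology.
Variables (R : realType) (k : fieldType) (n : nat).
Local Notation pmod := (pmod R k n).
Local Notation fpspace := (fpspace R k n).
Local Open Scope classical_set_scope.
Implicit Types (M N : pmod) (U : set fpspace) (x y : fpspace).

Lemma open_fpspaceP U : open U <-> forall x, U x ->
  exists A, [/\ finI_from [set B | exists x : fpspace, exists2 r : R, 0 < r &
    B = fpspace_ball x r] id A, A x & A `<=` U].
Proof.
split=> [[E ED <-] x [A EA Ax]|UP].
  by exists A; split=> [||y Ay]; [exact: ED | | exists A].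
exists [set A | finI_from [set B | exists x : fpspace, exists2 r : R, 0 < r &
    B = fpspace_ball x r] id A /\ A `<=` U]; first by move=> A [].
apply/seteqP; split=> [x [A [_ AU] /AU]//|x /UP[A [fA Ax AU]]].
by exists A.
Qed.

Lemma interleaved_refl r M : 0 <= r -> interleaved r M M.
Proof.
move=> r0; have [eta etaE] := pshift_eta M r0; apply/interleavedP => //.
by exists eta, eta; split=> s v; rewrite !etaE tr_tr ?translate_ge.
Qed.

Lemma fpspace_ballP x y r : fpspace_ball x r y <->
  exists2 e, 0 <= e < r & interleaved e (class_repr x) (class_repr y).
Proof.
split=> [/ereal_inf_lt[_ [e [e0 ie] <-]]|[e /andP[e0 er] ie]].
  by rewrite lte_fin => er; exists e; rewrite ?e0.
apply: (le_lt_trans (y := e%:E)); last by rewrite lte_fin.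
by apply: ereal_inf_lbound; exists e.
Qed.

Lemma indecomposable_eps e M : 0 < e -> pindecomposable M -> eps_indecomposable e M.
Proof.
move=> e0 Mi; exists M, (pzero R k n); split=> //.
  exists 0; first by rewrite lexx.
  by move=> s h; apply/lfunP => v; rewrite [LHS]thinmx0 [RHS]thinmx0.
have [iA [iB [pA [pB ip]]]] := psum_retracts M (pzero R k n).
apply/pisoP; exists iA, pA => s; have [iE _ pE _] := ip s; split=> [v|[v w]].
  by rewrite iE pE.
by rewrite iE pE; congr pair; rewrite [LHS]thinmx0 [RHS]thinmx0.
Qed.

Lemma eps_indecomposables_open e : open (@eps_indecomposables R k n e).
Proof.
apply/open_fpspaceP => x ex.
have [r r0 rP] := eps_indecomposable_open (class_repr_fp x) ex.
exists (fpspace_ball x r); split.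
- apply: finI_from1; first by exists x, r.
- apply/fpspace_ballP; exists 0; first by rewrite lexx.
  exact: interleaved_refl.
- move=> y /fpspace_ballP[d /andP[d0 dr] xy]; apply: (rP d) => //.
    by rewrite d0 ltW.
  exact: class_repr_fp.
Qed.

Lemma eps_indecomposables_dense e : (2 <= n)%N -> 0 < e ->
  dense (@eps_indecomposables R k n e).
Proof.
move=> n2 e0 U [x Ux] /open_fpspaceP/(_ x Ux)[A [[D DB <-] xA AU]].
(* A basic open set is a finite intersection of balls not centred at [x]; the triangle inequality
   gives a radius around [x] for each, and [small_forall] a common one. *)
have [|r r0 rP] := @small_forall R _
  (fun (i : finmap.fset_sub_type D) r => forall y,
    interleaved r (class_repr x) (class_repr y) -> val i y).
  move=> [B BD]; have : B x by exact: xA.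
  have /set_mem[c [r r0 BE]] := DB _ BD; rewrite {1}BE => /fpspace_ballP[d /andP[d0 dr] cx].
  exists ((r - d) / 2); first by lra.
  move=> r' /andP[r0' rr] y xy /=; rewrite BE; apply/fpspace_ballP.
  exists (d + r'); last exact: interleaved_trans cx xy.
  by lra.
have [N [fpN Ni xN]] := indecomposable_nearby n2 r0 (class_repr_fp x).
have [y Ny] := class_repr_surj fpN; exists y; split.
  apply: AU => B BD; apply: (rP r _ (finmap.FSetSub BD)); first by rewrite lexx ltW.
  by apply: interleaved_isor Ny => //; exact: ltW.
apply: indecomposable_eps => //; exact: pindecomposable_iso Ny Ni.
Qed.

End Topology.

Theorem corollary1p1 (R : realType) (k : fieldType) (n : nat) (eps : R) :
  (2 <= n)%N -> (0 < eps)%R ->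
  dense (@eps_indecomposables R k n eps) /\ open (@eps_indecomposables R k n eps).
Proof.
by move=> n2 eps0; split; [exact: eps_indecomposables_dense | exact: eps_indecomposables_open].
Qed.
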